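(* Let $A$ be a self-adjoint operator on a Hilbert space $\mathcal{H}$, let $\varphi\in\mathcal{H}_{-2}\setminus\mathcal{H}$, let $c\in\mathbb{R}$ be fixed, and let $A_{\alpha,c}=A+\alpha\langle\varphi_c,\cdot\rangle\varphi$ for $\alpha\in\mathbb{R}$. Let $\mathcal{M}$ be the cyclicity space of $(A-iI)^{-1}\varphi$. Then the set $$\Gamma_c:=\{\alpha\in\mathbb{R} : \sigma_p(A_{\alpha,c}\upharpoonright_{\mathcal{M}})\cap\sigma(A\upharpoonright_{\mathcal{M}})=\varnothing\}$$ contains a dense $G_\delta$ subset of $\mathbb{R}$.
   Context: $\mathcal{H}$ is a complex Hilbert space, with inner product conjugate-linear in the first argument. For $s\ge 0$, $\mathcal{H}_s=D(|A|^{s/2})$ with norm $\|x\|_s=\|(|A|+I)^{s/2}x\|$, and $\mathcal{H}_{-s}$ is the completion of $\mathcal{H}$ in the norm $\|(|A|+I)^{-s/2}x\|$, identified with the space of bounded functionals on $\mathcal{H}_s$; so $\mathcal{H}_2=D(A)$, and for $\varphi\in\mathcal{H}_{-2}$, $x\in\mathcal{H}_2$, $\langle\varphi,x\rangle$ is the duality pairing, extending the inner product by continuity. For $\varphi\in\mathcal{H}_{-2}$, $(A\pm iI)^{-1}\varphi\in\mathcal{H}$ is defined in the generalized sense: $\langle (A\pm iI)^{-1}\varphi,\eta\rangle=\langle\varphi,(A\mp iI)^{-1}\eta\rangle$ for all $\eta\in\mathcal{H}$. Put $A(A^2+I)^{-1}\varphi:=\frac12[(A-iI)^{-1}\varphi+(A+iI)^{-1}\varphi]\in\mathcal{H}$.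 Let $\varphi\in\mathcal{H}_{-2}\setminus\mathcal{H}$. The operator $\dot A:=A\upharpoonright_{D(\dot A)}$, $D(\dot A)=\{x\in D(A):\langle\varphi,x\rangle=0\}$, is a densely defined closed symmetric operator with deficiency indices $(1,1)$, and $D(\dot A^* )=D(A)\dotplus\mathrm{span}\{A(A^2+I)^{-1}\varphi\}$. For $c\in\mathbb{R}$, the functional $\varphi_c$ on $D(\dot A^* )$ extends $\varphi$ by $\langle\varphi_c,x+bA(A^2+I)^{-1}\varphi\rangle=\langle\varphi,x\rangle+bc$ for $x\in D(A)$, $b\in\mathbb{C}$. For $\alpha\in\mathbb{R}$ the formal expression $A_{\alpha,c}=A+\alpha\langle\varphi_c,\cdot\rangle\varphi$ denotes the self-adjoint operator obtained by restricting $\dot A^*$ to $$D(A_{\alpha,c})=\{x+bA(A^2+I)^{-1}\varphi : x\in D(A),\ b\in\mathbb{C},\ b+\alpha(\langle\varphi,x\rangle+bc)=0\}$$ (for $\alpha\ne0$ the condition reads $\langle\varphi,x\rangle=\gamma b$ with $\gamma=-(\frac1\alpha+c)$; and $A_{0,c}=A$). The cyclicity space of $(A-iI)^{-1}\varphi$ is $\mathcal{M}=\overline{\mathrm{span}\{(A-zI)^{-1}(A-iI)^{-1}\varphi: z\in\mathbb{C}\setminus\mathbb{R}\}}$. It reduces every $A_{\alpha,c}$ (and is unchanged if $A$ is replaced by $A_{\alpha,c}$ in the resolvents $(A-zI)^{-1}$); $A_{\alpha,c}\upharpoonright_{\mathcal{M}}$ is the self-adjoint operator on $\mathcal{M}$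 with domain $D(A_{\alpha,c})\cap\mathcal{M}$. $\sigma$ denotes spectrum and $\sigma_p$ the set of eigenvalues. *)

(* Defs.v *)
From HB Require Import structures.
From mathcomp Require Import all_boot all_order all_algebra.
From mathcomp Require Import complex.
From mathcomp Require Import all_classical all_reals all_analysis.
Set Implicit Arguments.
Unset Strict Implicit.
Unset Printing Implicit Defensive.
Import Order.TTheory GRing.Theory Num.Theory.
Import numFieldNormedType.Exports.
Local Open Scope classical_set_scope.
Local Open Scope complex_scope.
Local Open Scope ring_scope.

(* A complex Hilbert space is a complete normed module H over R[i] together    *)
(* with an inner product dot : {dot H for Num.conj} inducing its norm.         *)
Definition hilbert_norm (R : realType) (H : completeNormedModType R[i])
  (dot : {dot H for Num.conj}) : Prop := forall x : H, `|x| ^+ 2 = dot x x.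

(* {dot H for Num.conj} is linear in its first argument, whereas inner is      *)
(* linear in the second one and conjugate-linear in the first one.             *)
Definition inner (R : realType) (H : completeNormedModType R[i])
  (dot : {dot H for Num.conj}) (x y : H) : R[i] := dot y x.

(* An unbounded operator T is represented by its graph: T (x, y) means that x  *)
(* belongs to the domain of T and T x = y.                                     *)
Definition op_dom (H : Type) (T : set (H * H)) : set H :=
  [set x | exists y, T (x, y)].

Definition is_operator (R : realType) (H : completeNormedModType R[i])
  (T : set (H * H)) : Prop :=
  [/\ T (0, 0),
      forall (a : R[i]) x y x' y',
        T (x, y) -> T (x', y') -> T (a *: x + x', a *: y + y')
    & forall x y y', T (x, y) -> T (x, y') -> y = y'].

Definition op_restrict (H : Type) (T : set (H * H)) (D : set H) : set (H * H) :=
  [set p | T p /\ D p.1].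

Definition op_comp (H : Type) (T S : set (H * H)) : set (H * H) :=
  [set p | exists y, S (p.1, y) /\ T (y, p.2)].

Definition adjoint (R : realType) (H : completeNormedModType R[i])
  (dot : {dot H for Num.conj}) (T : set (H * H)) : set (H * H) :=
  [set p | forall x y, T (x, y) -> inner dot p.1 y = inner dot p.2 x].

Definition self_adjoint (R : realType) (H : completeNormedModType R[i])
  (dot : {dot H for Num.conj}) (T : set (H * H)) : Prop :=
  [/\ is_operator T, dense (op_dom T) & adjoint dot T = T].

(* B = |A| = (A^* A)^(1/2), the unique nonnegative self-adjoint square root.   *)
Definition is_modulus (R : realType) (H : completeNormedModType R[i])
  (dot : {dot H for Num.conj}) (A B : set (H * H)) : Prop :=
  [/\ self_adjoint dot B,
      forall x y, B (x, y) -> 0 <= inner dot x y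
    & op_comp B B = op_comp (adjoint dot A) A].

(* H_{-2} as the space of bounded linear functionals on H_2 = D(|A|), normed   *)
(* by |x|_2 = |(|A| + I) x|. The value phi x is the pairing <phi, x>; only the *)
(* values of phi on H_2 are meaningful.                                        *)
Definition in_Hm2 (R : realType) (H : completeNormedModType R[i])
  (dot : {dot H for Num.conj}) (A : set (H * H)) (phi : H -> R[i]) : Prop :=
  exists B, [/\ is_modulus dot A B,
    forall (a : R[i]) x y, op_dom B x -> op_dom B y ->
      phi (a *: x + y) = a * phi x + phi y
  & exists K : R, forall x y, B (x, y) -> `|phi x| <= K%:C * `|y + x|].

Definition in_H (R : realType) (H : completeNormedModType R[i])
  (dot : {dot H for Num.conj}) (A : set (H * H)) (phi : H -> R[i]) : Prop :=
  exists h : H, forall x, op_dom A x -> phi x = inner dot h x.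

(* Graph of (A - zI)^{-1}. *)
Definition resolvent (R : realType) (H : completeNormedModType R[i])
  (A : set (H * H)) (z : R[i]) : set (H * H) :=
  [set p | A (p.2, p.1 + z *: p.2)].

(* (A - zI)^{-1} phi in the generalized sense, for non-real z: the vector u    *)
(* with <u, eta> = <phi, (A - z^* I)^{-1} eta> for all eta. For phi in H_{-2}  *)
(* it exists and is unique, so the default value 0 of xget is not used.        *)
Definition gen_resolvent (R : realType) (H : completeNormedModType R[i])
  (dot : {dot H for Num.conj}) (A : set (H * H)) (phi : H -> R[i])
  (z : R[i]) : H :=
  xget 0 [set u : H | forall eta x : H,
    resolvent A (Num.conj z) (eta, x) -> inner dot u eta = phi x].

(* A (A^2 + I)^{-1} phi *)
Definition defect_vec (R : realType) (H : completeNormedModType R[i])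
  (dot : {dot H for Num.conj}) (A : set (H * H)) (phi : H -> R[i]) : H :=
  2%:R^-1 *: (gen_resolvent dot A phi 'i + gen_resolvent dot A phi (- 'i)).

Definition A_dot (R : realType) (H : completeNormedModType R[i])
  (A : set (H * H)) (phi : H -> R[i]) : set (H * H) :=
  op_restrict A [set x | phi x = 0].

(* <phi_c, x + b A (A^2 + I)^{-1} phi> for x in D(A), as a function of (x, b). *)
Definition phi_ext (R : realType) (H : completeNormedModType R[i])
  (phi : H -> R[i]) (c : R) (x : H) (b : R[i]) : R[i] := phi x + b * c%:C.

(* A_{alpha, c} = A + alpha <phi_c, .> phi *)
Definition A_pert (R : realType) (H : completeNormedModType R[i])
  (dot : {dot H for Num.conj}) (A : set (H * H)) (phi : H -> R[i])
  (c alpha : R) : set (H * H) :=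
  op_restrict (adjoint dot (A_dot A phi))
    [set v | exists (x : H) (b : R[i]),
       [/\ op_dom A x, v = x + b *: defect_vec dot A phi
         & b + alpha%:C * phi_ext phi c x b = 0]].

Definition lin_span (R : realType) (H : completeNormedModType R[i])
  (S : set H) : set H :=
  [set x | exists n (a : 'I_n -> R[i]) (v : 'I_n -> H),
     (forall k, S (v k)) /\ x = \sum_(k < n) a k *: v k].

Definition cyclicity_space (R : realType) (H : completeNormedModType R[i])
  (A : set (H * H)) (g : H) : set H :=
  closure (lin_span
    [set x | exists z : R[i], complex.Im z != 0 /\ resolvent A z (g, x)]).

(* Spectrum of T as an operator on the closed subspace M (so that the graph of *)
(* T is contained in M `*` M).                                                 *)
Definition resolvent_set (R : realType) (H : completeNormedModType R[i])
  (M : set H) (T : set (H * H)) : set R[i] :=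
  [set z | (forall eta, M eta -> exists! x, resolvent T z (eta, x)) /\
           exists K : R, forall eta x,
             resolvent T z (eta, x) -> `|x| <= K%:C * `|eta|].

Definition spectrum (R : realType) (H : completeNormedModType R[i])
  (M : set H) (T : set (H * H)) : set R[i] := ~` resolvent_set M T.

Definition point_spectrum (R : realType) (H : completeNormedModType R[i])
  (T : set (H * H)) : set R[i] :=
  [set z | exists x, x != 0 /\ T (x, z *: x)].

Definition Gamma (R : realType) (H : completeNormedModType R[i])
  (dot : {dot H for Num.conj}) (A : set (H * H)) (phi : H -> R[i]) (c : R) :
  set R :=
  let M := cyclicity_space A (gen_resolvent dot A phi 'i) in
  [set alpha | point_spectrum (op_restrict (A_pert dot A phi c alpha) M)
               `&` spectrum M (op_restrict A M) = set0].

(* Main.v *)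
From HB Require Import structures.
Require Import Defs.
From mathcomp Require Import all_boot all_order all_algebra.
From mathcomp Require Import complex.
From mathcomp Require Import all_classical all_reals all_analysis.
From mathcomp Require Import borel_hierarchy.
From mathcomp Require Import ring lra.
Import Order.TTheory GRing.Theory Num.Theory.
Import numFieldNormedType.Exports.
Local Open Scope classical_set_scope.
Local Open Scope complex_scope.
Local Open Scope ring_scope.

(** For alpha <> 0, an eigenvector of A_{alpha,c} in M with real eigenvalue E is a
multiple of psi = (A - E)^-1 phi, understood in the weak sense of
[weak_resolvent], and the boundary condition then says
  coupling E = - 1/alpha - c,
where coupling E = <phi, psi - A (A^2 + I)^-1 phi>
([eigenvector_weak_resolvent]). So it is enough to show that the image under
[coupling] of those E in the spectrum of A on M for which psi exists is meagre:
the parameters alpha <> 0 for which - 1/alpha - c avoids this image then contain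
a dense G_delta by the Baire category theorem ([generic_parameters]).

The vector psi exists with |psi| <= K exactly when |phi y| <= K |(A - E) y| on
D(A) ([regular], [regular_weak_resolvent]), which is a closed condition on E.
From (A - E) psi = (A - E') psi' = phi one computes
  coupling E - coupling E' = (E - E') <psi', psi>,
so [coupling] is Lipschitz on the K-regular energies, and its difference
quotients at E tend to |psi|^2 > 0 along them ([coupling_slope]). The energies
of interest are therefore covered by countably many compact pieces on which
[coupling] is strictly increasing. The image of such a piece is closed, and it
has empty interior as soon as the piece has: a gap in the piece is a jump of the
inverse function ([increasing_image_empty_interior]).

It remains to see that no interval of K-regular energies meets the spectrum of A
on M ([regular_interval_resolvent_set]). In terms of the spectral measure mu of
phi, K-regularity at E gives mu(]E - h, E + h[) <= K^2 h^2; covering an interval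
by O(1/h) intervals of length h gives it mass O(h), hence mass zero. The proof
below replaces the spectral measure by an inequality between rational functions
of A. For real x and a grid e_j of mesh h on [E0 - d, E0 + d],
  (x - E0)^2 + 4 d^2 sum_j h^2 / ((x - e_j)^2 + h^2) > d^2   ([grid_cover]).
Clearing denominators gives a polynomial that is positive on the real line, hence
of the form |s|^2 ([positive_poly_factor]), and the value of |s|^2 at the
symmetric operator A is a squared norm; so the inequality persists with A in
place of x ([grid_inequality]). On resolvent combinations of (A - iI)^-1 phi the
sum is O(h), because (A - e_j - ih)^-1 phi has norm at most K. Letting h tend to
0 leaves |(A - E0) y| >= d |y|, which extends to D(A) in M and makes A - E0
invertible there. *)

Set Implicit Arguments.
Unset Strict Implicit.
Unset Printing Implicit Defensive.

Local Notation cabs z := (complex.Re `|z|).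

(** * Complex modulus and inner product *)

Section ComplexModulus.
Context {R : realType}.
Implicit Types z w : R[i].

Lemma normCE z : `|z| = (cabs z)%:C.
Proof. by rewrite normc_def. Qed.

Lemma rcD (r s : R) : (r + s)%:C = r%:C + s%:C. Proof. exact: rmorphD. Qed.
Lemma rcB (r s : R) : (r - s)%:C = r%:C - s%:C. Proof. exact: rmorphB. Qed.
Lemma rcM (r s : R) : (r * s)%:C = r%:C * s%:C. Proof. exact: rmorphM. Qed.
Lemma rcX (r : R) n : (r ^+ n)%:C = r%:C ^+ n. Proof. exact: rmorphXn. Qed.
Lemma rc_nat n : (n%:R : R)%:C = n%:R. Proof. exact: rmorph_nat. Qed.
Lemma conj_rc (r : R) : Num.conj r%:C = r%:C. Proof. exact: conjc_real. Qed.
Lemma ReD z w : complex.Re (z + w) = complex.Re z + complex.Re w.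
Proof. by case: z w => [? ?] [? ?]. Qed.
Lemma ReB z w : complex.Re (z - w) = complex.Re z - complex.Re w.
Proof. by case: z w => [? ?] [? ?]. Qed.
Lemma ReN z : complex.Re (- z) = - complex.Re z.
Proof. by case: z. Qed.
Lemma ReZ (r : R) z : complex.Re (r%:C * z) = r * complex.Re z.
Proof. by case: z => a b /=; rewrite mul0r subr0. Qed.
Lemma Re_conj z : complex.Re (Num.conj z) = complex.Re z.
Proof. by case: z. Qed.
Lemma Re_addJ z : z + Num.conj z = (2 * complex.Re z)%:C.
Proof. by rewrite rcM rc_nat -addcJ. Qed.
Lemma normCJ z : z * Num.conj z = ((cabs z) ^+ 2)%:C.
Proof. by rewrite rcX -normCE normCK. Qed.

Lemma cabs_ge0 z : 0 <= cabs z.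
Proof. by rewrite -lecR -normCE normr_ge0. Qed.

Lemma cabsD z w : cabs (z + w) <= cabs z + cabs w.
Proof. by rewrite -lecR rmorphD /= -!normCE ler_normD. Qed.

Lemma cabsM z w : cabs (z * w) = cabs z * cabs w.
Proof. by apply: complexI; rewrite rmorphM /= -!normCE normrM. Qed.

Lemma cabsN z : cabs (- z) = cabs z.
Proof. by rewrite normrN. Qed.

Lemma cabsJ z : cabs (Num.conj z) = cabs z.
Proof. by rewrite -[Num.conj z]/(z^*%C) normcJ. Qed.

Lemma cabs_real (r : R) : cabs r%:C = `|r|.
Proof. by rewrite normc_def /= expr0n /= addr0 sqrtr_sqr. Qed.

Lemma cabs_eq0 z : cabs z = 0 -> z = 0.
Proof. by move=> h; apply/eqP; rewrite -normr_eq0 normCE h. Qed.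

Lemma cabs_gt0 z : z != 0 -> 0 < cabs z.
Proof.
by move=> z0; rewrite lt_neqAle cabs_ge0 andbT eq_sym; apply: contra_neq z0; exact: cabs_eq0.
Qed.

Lemma cabs_sqr z : (cabs z) ^+ 2 = (complex.Re z) ^+ 2 + (complex.Im z) ^+ 2.
Proof. by apply: complexI; rewrite rmorphXn /= -normCE add_Re2_Im2. Qed.

Lemma Re_le_cabs z : complex.Re z <= cabs z.
Proof.
by apply: le_trans (ler_norm _) _; rewrite -lecR -normCE; exact: normc_ge_Re.
Qed.

Lemma cabs_Im_le z : `|complex.Im z| <= cabs z.
Proof.
rewrite -(@ler_pXn2r _ 2) ?nnegrE ?cabs_ge0// cabs_sqr real_normK ?num_real//.
by rewrite lerDr sqr_ge0.
Qed.

Lemma cabs_iM (t : R) : cabs (t *i)%C = `|t|.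
Proof. by rewrite normc_def /= expr0n /= add0r sqrtr_sqr. Qed.

End ComplexModulus.

Section InnerProduct.
Context {R : realType} {H : completeNormedModType R[i]}.
Context {dot : {dot H for Num.conj}}.
Context (hH : hilbert_norm dot).
Implicit Types (x y u v : H) (a z : R[i]).

Local Notation ip := (inner dot).

(** The norm of H takes its values in R[i], which is only partially ordered;
its real part makes the norm available to ordered-field arithmetic. *)
Definition nrm x : R := complex.Re `|x|.

Lemma nrmE x : `|x| = (nrm x)%:C.
Proof. by rewrite /nrm RRe_real // normr_real. Qed.

Lemma nrm_ge0 x : 0 <= nrm x.
Proof. by rewrite -lecR -nrmE normr_ge0. Qed.

Lemma nrm0 : nrm 0 = 0.
Proof. by rewrite /nrm normr0. Qed.

Lemma nrm_eq0 x : nrm x = 0 -> x = 0.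
Proof. by move=> h; apply/eqP; rewrite -normr_eq0 nrmE h. Qed.

Lemma nrm_gt0 x : x != 0 -> 0 < nrm x.
Proof.
by move=> x0; rewrite lt_neqAle nrm_ge0 andbT eq_sym; apply: contra_neq x0; exact: nrm_eq0.
Qed.

Lemma nrmD x y : nrm (x + y) <= nrm x + nrm y.
Proof. by rewrite -lecR rmorphD /= -!nrmE ler_normD. Qed.

Lemma nrmN x : nrm (- x) = nrm x.
Proof. by rewrite /nrm normrN. Qed.

Lemma nrmB x y : nrm (x - y) <= nrm x + nrm y.
Proof. by rewrite -(nrmN y) nrmD. Qed.

Lemma nrm_sub x y : nrm (x - y) = nrm (y - x).
Proof. by rewrite -nrmN opprB. Qed.

Lemma nrm_tri y x u : nrm (x - u) <= nrm (x - y) + nrm (y - u).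
Proof. by apply: le_trans (nrmD _ _); rewrite addrA subrK. Qed.

Lemma nrmZ a x : nrm (a *: x) = cabs a * nrm x.
Proof. by apply: complexI; rewrite rmorphM /= -normCE -!nrmE normrZ. Qed.

Lemma ipC x y : ip x y = Num.conj (ip y x).
Proof. by rewrite /inner (hermC dot) expr0 mul1r. Qed.

Lemma ipDr x y u : ip u (x + y) = ip u x + ip u y.
Proof. exact: linearDl. Qed.

Lemma ipDl x y u : ip (x + y) u = ip x u + ip y u.
Proof. exact: linearDr. Qed.

Lemma ipNr x u : ip u (- x) = - ip u x.
Proof. exact: linearNl. Qed.

Lemma ipNl x u : ip (- x) u = - ip x u.
Proof. exact: linearNr. Qed.

Lemma ipBr x y u : ip u (x - y) = ip u x - ip u y.
Proof. by rewrite ipDr ipNr. Qed.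

Lemma ipBl x y u : ip (x - y) u = ip x u - ip y u.
Proof. by rewrite ipDl ipNl. Qed.

Lemma ipZr a x u : ip u (a *: x) = a * ip u x.
Proof. exact: linearZl_LR. Qed.

Lemma ipZl a x u : ip (a *: x) u = Num.conj a * ip x u.
Proof. exact: linearZr_LR. Qed.

Lemma ip0r u : ip u 0 = 0.
Proof. exact: linear0l. Qed.

Lemma ip0l u : ip 0 u = 0.
Proof. exact: linear0r. Qed.

Lemma ip_sumr n (f : 'I_n -> H) u : ip u (\sum_(k < n) f k) = \sum_(k < n) ip u (f k).
Proof. exact: linear_sumlz. Qed.

Lemma ip_suml n (f : 'I_n -> H) u : ip (\sum_(k < n) f k) u = \sum_(k < n) ip (f k) u.
Proof. exact: linear_sumr. Qed.

Lemma ipxx x : ip x x = ((nrm x) ^+ 2)%:C.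
Proof. by rewrite /inner -hH nrmE rmorphXn. Qed.

Lemma CauchySchwarz x y : cabs (ip x y) <= nrm x * nrm y.
Proof.
have [->|y0] := eqVneq y 0; first by rewrite ip0r normr0 nrm0 mulr0.
have ny := nrm_gt0 y0.
have [Y eY] : {Y | Y = (nrm y) ^+ 2} by exists ((nrm y) ^+ 2).
have [X eX] : {X | X = (nrm x) ^+ 2} by exists ((nrm x) ^+ 2).
set c := ip y x.
(* This vector is |y|^2 times the component of x orthogonal to y. *)
have hu : (nrm (Y%:C *: x - c *: y)) ^+ 2 = Y * (Y * X - (cabs c) ^+ 2).
  apply: complexI; rewrite -ipxx.
  rewrite ipBl !ipBr !ipZl !ipZr !ipxx -/c (ipC x y) -/c -eY -eX.
  by rewrite conj_rc rcM rcB rcM -normCJ; ring.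
have h0 : 0 <= Y * (Y * X - (cabs c) ^+ 2) by rewrite -hu sqr_ge0.
rewrite pmulr_rge0 ?eY ?exprn_gt0// subr_ge0 eX -exprMn in h0.
rewrite ipC cabsJ -/c mulrC.
by rewrite -(@ler_pXn2r _ 2) ?nnegrE ?cabs_ge0// mulr_ge0 ?nrm_ge0.
Qed.

Lemma nrm_sqrD x y :
  (nrm (x + y)) ^+ 2 = (nrm x) ^+ 2 + (nrm y) ^+ 2 + 2 * complex.Re (ip x y).
Proof.
apply: complexI; rewrite -ipxx ipDl !ipDr !ipxx (ipC y x).
by rewrite 2!rcD -Re_addJ; ring.
Qed.

End InnerProduct.

(** * Sequences, closures and Riesz representation *)

Section Limits.
Context {R : realType} {H : completeNormedModType R[i]}.
Implicit Types (x y : H) (u : nat -> H).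

(** Convergence for the real-valued norm [nrm]. *)
Definition tends u x := forall e : R, 0 < e ->
  exists N, forall n, (N <= n)%N -> nrm (u n - x) < e.

Lemma eventually_invS_lt (e : R) : 0 < e -> exists N, forall n, (N <= n)%N -> n.+1%:R^-1 < e.
Proof.
move=> e0; exists (Num.bound e^-1) => n hn.
rewrite invf_plt ?posrE ?ltr0n//.
apply: lt_le_trans (archi_boundP _) _; first by rewrite invr_ge0 ltW.
by rewrite ler_nat ltnW.
Qed.

(** Passage to the limit in an inequality with an error term K e. *)
Lemma le_of_eps (a b K : R) : 0 <= K -> (forall e, 0 < e -> a <= b + K * e) -> a <= b.
Proof.
move=> K0 h; apply/ler_addgt0Pr => e e0.
have K1 : 0 < K + 1 by apply: ltr_wpDl.
apply: le_trans (h (e / (K + 1)) _) _; first by rewrite divr_gt0.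
rewrite lerD2l mulrCA ler_piMr ?(ltW e0)// ler_pdivrMr// mul1r lerDl ler01.
done.
Qed.

Lemma cauchy_tends u :
  (forall e : R, 0 < e -> exists N, forall m n, (N <= m)%N -> (N <= n)%N ->
     nrm (u m - u n) < e) ->
  exists x, tends u x.
Proof.
move=> hu.
have cu : cauchy (u @ \oo).
  apply: cauchy_exP => e e0.
  have er : e = (complex.Re e)%:C by rewrite RRe_real// gtr0_real.
  have e1 : 0 < complex.Re e by rewrite -ltcR -er.
  have [N hN] := hu _ e1.
  exists (u N), N => // n /= hn.
  rewrite -ball_normE /= er nrmE ltcR.
  exact: hN.
have cv : cvg (u @ \oo) by exact: cauchy_cvg.
exists (lim (u @ \oo)) => e e0.
have := @cvgr_distC_lt _ _ _ _ _ _ _ cv e%:C.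
rewrite ltcR => /(_ _ e0) [N _ hN].
by exists N => n hn; rewrite -ltcR -nrmE; exact: hN.
Qed.

Lemma closureE (S : set H) x :
  closure S x <-> forall e : R, 0 < e -> exists2 s, S s & nrm (s - x) < e.
Proof.
split=> [h e e0|h B /nbhs_ballP[e /= e0 hB]].
  have /h[s [Ss]] : nbhs x (ball x e%:C).
    by apply/nbhs_ballP; exists e%:C => //=; rewrite ltcR.
  by rewrite -ball_normE /= nrmE ltcR nrm_sub => hs; exists s.
have er : e = (complex.Re e)%:C by rewrite RRe_real// gtr0_real.
have e1 : 0 < complex.Re e by rewrite -ltcR -er.
have [s Ss hs] := h _ e1; exists s; split => //.
by apply: hB; rewrite -ball_normE /= er nrmE ltcR nrm_sub.
Qed.

Lemma denseE (S : set H) x (e : R) : dense S -> 0 < e -> exists2 s, S s & nrm (s - x) < e.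
Proof.
move=> dS e0; have [] := dS (ball x e%:C).
- by exists x; apply: ballxx; rewrite ltcR.
- by apply: ball_open; rewrite ltcR.
move=> s [hs Ss]; exists s => //.
by rewrite -ltcR -nrmE; move: hs; rewrite -ball_normE /= distrC.
Qed.

Lemma tends_closure (S : set H) u x : (forall n, S (u n)) -> tends u x -> closure S x.
Proof.
by move=> Su ux; apply/closureE => e /ux[N /(_ N (leqnn N)) h]; exists (u N).
Qed.

Lemma closure_tends (S : set H) x : closure S x -> exists2 u, (forall n, S (u n)) & tends u x.
Proof.
move=> /closureE h.
have /choice[u hu] n : exists s, S s /\ nrm (s - x) < n.+1%:R^-1.
  by have [|s] := h n.+1%:R^-1; [rewrite invr_gt0 ltr0n|exists s].
exists u => [n|e /eventually_invS_lt[N hN]]; first by have [] := hu n.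
by exists N => n /hN; apply: lt_trans; have [] := hu n.
Qed.

Lemma tends_nrm_le u x (K : R) : tends u x -> (exists N, forall n, (N <= n)%N -> nrm (u n) <= K) ->
  nrm x <= K.
Proof.
move=> ux [M hM]; apply: (@le_of_eps _ _ 1) => // e e0.
have [N hN] := ux _ e0.
have := hN (maxn N M) (leq_maxl _ _); have := hM (maxn N M) (leq_maxr _ _).
have := nrm_tri (u (maxn N M)) x 0; rewrite !subr0 (nrm_sub x); lra.
Qed.

Lemma tendsD u v x y : tends u x -> tends v y -> tends (fun n => u n + v n) (x + y).
Proof.
move=> ux vy e e0.
have e2 : 0 < e / 2 by rewrite divr_gt0.
have [N hN] := ux _ e2; have [M hM] := vy _ e2.
exists (maxn N M) => n hn.
have := hN n (leq_trans (leq_maxl _ _) hn); have := hM n (leq_trans (leq_maxr _ _) hn).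
have := nrmD (u n - x) (v n - y).
rewrite (_ : u n - x + (v n - y) = u n + v n - (x + y)); last by rewrite opprD addrACA.
lra.
Qed.

Lemma tends_lip (f : H -> H) (K : R) u x :
  (forall n, nrm (f (u n) - f x) <= K * nrm (u n - x)) -> tends u x ->
  tends (fun n => f (u n)) (f x).
Proof.
move=> hf ux e e0.
have K1 : 0 < `|K| + 1 by apply: ltr_wpDl.
have [N hN] := ux _ (divr_gt0 e0 K1).
exists N => n /hN; rewrite ltr_pdivlMr// => h.
apply: le_lt_trans (hf n) (le_lt_trans _ h).
rewrite mulrC ler_wpM2l ?nrm_ge0//.
by apply: le_trans (ler_norm _) _; rewrite lerDl.
Qed.

Lemma tendsZ (a : R[i]) u x : tends u x -> tends (fun n => a *: u n) (a *: x).
Proof. by apply: (@tends_lip _ (cabs a)) => n; rewrite -scalerBr nrmZ. Qed.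

End Limits.

Section Riesz.
Context {R : realType} {H : completeNormedModType R[i]}.
Context {dot : {dot H for Num.conj}}.
Context (hH : hilbert_norm dot).
Local Notation ip := (inner dot).

(** V need not be closed. The vector p minimizes |v|^2 - 2 Re (f v) over the closure
of V: minimizing sequences in V are Cauchy by the parallelogram law, and the
first variation vanishes at the limit. With f = <h, .> this is the orthogonal
projection of h on the closure of V. *)
Lemma riesz_subspace (V : set H) (f : H -> R[i]) (K : R) :
  V 0 -> (forall a x y, V x -> V y -> V (a *: x + y)) ->
  (forall a x y, V x -> V y -> f (a *: x + y) = a * f x + f y) ->
  (forall x, V x -> cabs (f x) <= K * nrm x) -> 0 <= K ->
  exists p, [/\ closure V p, nrm p <= K & forall v, V v -> ip p v = f v].
Proof.
move=> V0 VL fL fK K0.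
have VZ a x : V x -> V (a *: x) by move=> Vx; rewrite -[_ *: _]addr0; exact: VL.
have f0 : f 0 = 0.
  have := fL 1 0 0 V0 V0; rewrite scaler0 addr0 mul1r => /eqP.
  by rewrite -subr_eq0 opprD addNKr oppr_eq0 => /eqP.
have fZ a x : V x -> f (a *: x) = a * f x.
  by move=> Vx; rewrite -[_ *: _]addr0 fL// f0 addr0.
have fD x y : V x -> V y -> f (x + y) = f x + f y.
  by move=> Vx Vy; rewrite -[x]scale1r fL// mul1r scale1r.
pose J v := (nrm v) ^+ 2 - 2 * complex.Re (f v).
have J_ge v : V v -> - K ^+ 2 <= J v.
  move=> Vv; rewrite /J; have := fK _ Vv; have := Re_le_cabs (f v).
  by have := nrm_ge0 v; have := sqr_ge0 (nrm v - K); nra.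
pose d := inf [set J v | v in V].
have hinf : has_inf [set J v | v in V].
  split; first by exists (J 0), 0.
  by exists (- K ^+ 2) => _ [v Vv <-]; exact: J_ge.
have d_le v : V v -> d <= J v.
  by move=> Vv; apply: ge_inf; [exact: hinf.2|exists v].
have /choice[u hu] n : exists v, V v /\ J v < d + n.+1%:R^-1.
  have [|_ [v Vv <-] hv] := @inf_adherent _ [set J v | v in V] n.+1%:R^-1 _ hinf.
    by rewrite invr_gt0 ltr0n.
  by exists v.
(* The parallelogram law, with d_le at the midpoint of x and y. *)
have Jpar (x y : H) (e : R) : V x -> V y -> J x < d + e -> J y < d + e ->
    (nrm (x - y)) ^+ 2 <= 4 * e.
  move=> Vx Vy hx hy.
  have Vh : V ((2%:R^-1 : R)%:C *: (x + y)).
    by apply: VZ; rewrite -[x]scale1r; exact: VL.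
  have := d_le _ Vh; rewrite {1}/J nrmZ cabs_real ger0_norm; last by rewrite invr_ge0.
  rewrite fZ ?ReZ; last by rewrite -[x]scale1r; exact: VL.
  rewrite fD// ReD exprMn (nrm_sqrD hH x y) (nrm_sqrD hH x (- y)) nrmN ipNr ReN.
  move: hx hy; rewrite /J; nra.
have [p up] : exists p, tends u p.
  apply: cauchy_tends => e e0.
  have e4 : 0 < e ^+ 2 / 4 by rewrite divr_gt0 ?exprn_gt0.
  have [N hN] := eventually_invS_lt e4; exists N => m n hm hn.
  have [Vm Jm] := hu m; have [Vn Jn] := hu n.
  rewrite -(@ltr_pXn2r _ 2) ?nnegrE ?nrm_ge0 ?(ltW e0)//.
  apply: le_lt_trans (@Jpar _ _ (Num.max m.+1%:R^-1 n.+1%:R^-1) Vm Vn _ _) _.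
  - by apply: lt_le_trans Jm _; rewrite lerD2l le_max lexx.
  - by apply: lt_le_trans Jn _; rewrite lerD2l le_max lexx orbT.
  have : Num.max m.+1%:R^-1 n.+1%:R^-1 < e ^+ 2 / 4 by rewrite gt_max !hN.
  lra.
have ipf v : V v -> ip p v = f v.
  move=> Vv.
  have [->|v0] := eqVneq v 0; first by rewrite ip0r f0.
  have nv := nrm_gt0 v0.
  (* Comparison of J at u n with its value at the best point of the line through
     u n in the direction of v. *)
  have var n : (cabs (ip (u n) v - f v)) ^+ 2 <= n.+1%:R^-1 * (nrm v) ^+ 2.
    have [Vn Jn] := hu n; set c := ip (u n) v - f v.
    pose r := ((nrm v) ^+ 2)^-1.
    pose t := - (r%:C * Num.conj c).
    have := d_le _ (VL t _ _ Vv Vn).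
    rewrite /J fL// [t *: v + _]addrC (nrm_sqrD hH) nrmZ ipZr.
    have -> : complex.Re (t * f v + f (u n)) = complex.Re (t * f v) + complex.Re (f (u n)).
      by rewrite ReD.
    have tc : complex.Re (t * ip (u n) v) = complex.Re (t * f v) - r * (cabs c) ^+ 2.
      rewrite -[X in _ * X](subrK (f v)) -/c mulrDr ReD addrC; congr (_ + _).
      by rewrite /t mulNr ReN -mulrA [Num.conj c * c]mulrC normCJ ReZ.
    have ct : cabs t = r * cabs c.
      by rewrite /t cabsN cabsM cabs_real cabsJ ger0_norm// /r invr_ge0 sqr_ge0.
    rewrite tc ct; move: Jn; rewrite /J => Jn hd.
    rewrite -ler_pdivrMr ?exprn_gt0// -/r [_ * r]mulrC.
    have rv : r * (nrm v) ^+ 2 = 1 by rewrite /r mulVf// gt_eqF// exprn_gt0.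
    have e1 : (r * cabs c * nrm v) ^+ 2 = r * (cabs c) ^+ 2.
      by rewrite !exprMn -[RHS]mulr1 -rv; ring.
    rewrite e1 in hd; move: hd Jn.
    move: (_ * cabs c ^+ 2) (complex.Re (t * f v)) (complex.Re (f (u n))) (n.+1%:R^-1) (nrm (u n) ^+ 2).
    by move=> *; lra.
  apply/eqP; rewrite -subr_eq0; apply/eqP/cabs_eq0/eqP.
  rewrite eq_le cabs_ge0 andbT.
  apply: (@le_of_eps _ _ _ (2 * nrm v)); first by rewrite mulr_ge0 ?nrm_ge0.
  move=> e e0; rewrite add0r.
  have [N hN] := up _ e0.
  have [M hM] := eventually_invS_lt (exprn_gt0 2 e0).
  have h1 := hN _ (leq_maxl N M); have h2 := hM _ (leq_maxr N M).
  set n := maxn N M in h1 h2.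
  have -> : ip p v - f v = - ip (u n - p) v + (ip (u n) v - f v) by rewrite ipBl; ring.
  apply: le_trans (cabsD _ _) _; rewrite cabsN.
  have h3 := CauchySchwarz hH (u n - p) v.
  have h4 : cabs (ip (u n) v - f v) <= e * nrm v.
    rewrite -(@ler_pXn2r _ 2) ?nnegrE ?cabs_ge0 ?mulr_ge0 ?nrm_ge0 ?(ltW e0)//.
    by apply: le_trans (var n) _; rewrite exprMn ler_wpM2r ?sqr_ge0// ltW.
  nra.
exists p; split => //.
  by apply: tends_closure up => n; have [] := hu n.
have pK : (nrm p) ^+ 2 <= K * nrm p.
  apply: (@le_of_eps _ _ _ (nrm p + K)); first by rewrite addr_ge0 ?nrm_ge0.
  move=> e e0; have [N /(_ N (leqnn N)) hN] := up _ e0.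
  have [VN _] := hu N.
  have -> : (nrm p) ^+ 2 = complex.Re (ip p (p - u N) + f (u N)).
    by rewrite ipBr -ipf// subrK (ipxx hH).
  rewrite ReD.
  have := Re_le_cabs (ip p (p - u N)); have := CauchySchwarz hH p (p - u N).
  have := Re_le_cabs (f (u N)); have := fK _ VN.
  have := nrm_tri p (u N) 0; rewrite !subr0 (nrm_sub p); have := nrm_ge0 p.
  nra.
have [->|p0] := eqVneq (nrm p) 0; first by [].
by rewrite expr2 ler_pM2r // in pK; rewrite lt_neqAle eq_sym p0 nrm_ge0.
Qed.

End Riesz.

(** * Resolvents of a self-adjoint operator *)

Section SelfAdjoint.
Context {R : realType} {H : completeNormedModType R[i]}.
Context {dot : {dot H for Num.conj}}.
Context (hH : hilbert_norm dot).
Context {A : set (H * H)}.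
Context (hA : self_adjoint dot A).
Implicit Types (x y h : H) (z w a : R[i]).
Local Notation ip := (inner dot).

Lemma graph0 : A (0, 0).
Proof. by case: hA => -[]. Qed.

Lemma graph_lin a x y x' y' : A (x, y) -> A (x', y') -> A (a *: x + x', a *: y + y').
Proof. by case: hA => -[_ h _] _ _; exact: h. Qed.

Lemma graph_fun x y y' : A (x, y) -> A (x, y') -> y = y'.
Proof. by case: hA => -[_ _ h] _ _; exact: h. Qed.

Lemma graphD x y x' y' : A (x, y) -> A (x', y') -> A (x + x', y + y').
Proof. by move=> h /(graph_lin 1 h); rewrite !scale1r. Qed.

Lemma graphZ a x y : A (x, y) -> A (a *: x, a *: y).
Proof. by move=> h; have := graph_lin a h graph0; rewrite !addr0. Qed.

Lemma graphB x y x' y' : A (x, y) -> A (x', y') -> A (x - x', y - y').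
Proof. by move=> h /(graphZ (-1)); rewrite !scaleN1r; exact: graphD. Qed.

Lemma graph_sym x y x' y' : A (x, y) -> A (x', y') -> ip x y' = ip y x'.
Proof.
case: hA => _ _ e h h'; have : adjoint dot A (x, y) by rewrite e.
by move=> /(_ _ _ h').
Qed.

Lemma graph_adj v v' : (forall x y, A (x, y) -> ip v y = ip v' x) -> A (v, v').
Proof. by case: hA => _ _ e h; rewrite -e => x y; exact: h. Qed.

Lemma graph_closed (u v : nat -> H) x y :
  (forall n, A (u n, v n)) -> tends u x -> tends v y -> A (x, y).
Proof.
move=> huv ux vy; apply: graph_adj => s t st.
apply/eqP; rewrite -subr_eq0; apply/eqP/cabs_eq0/eqP.
rewrite eq_le cabs_ge0 andbT.
apply: (@le_of_eps _ _ _ (nrm t + nrm s)); first by rewrite addr_ge0 ?nrm_ge0.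
move=> e e0; rewrite add0r.
have [N hN] := ux _ e0; have [M hM] := vy _ e0.
have h1 := hN _ (leq_maxl N M); have h2 := hM _ (leq_maxr N M).
set n := maxn N M in h1 h2.
have -> : ip x t - ip y s = - ip (u n - x) t + ip (v n - y) s.
  by rewrite !ipBl (graph_sym (huv n) st); ring.
apply: le_trans (cabsD _ _) _; rewrite cabsN.
have := CauchySchwarz hH (u n - x) t; have := CauchySchwarz hH (v n - y) s.
have := nrm_ge0 t; have := nrm_ge0 s; nra.
Qed.

Lemma graph_ip_real x y : A (x, y) -> complex.Im (ip y x) = 0.
Proof.
move=> h; have := graph_sym h h; rewrite ipC; case: (ip y x) => a b /= [].
by move=> /eqP; rewrite eq_sym -subr_eq0 opprK -mulr2n mulrn_eq0 /= => /eqP.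
Qed.

(** The cross term vanishes because <A x, x> is real. *)
Lemma graph_nrm z x y : A (x, y) ->
  (nrm (y - z *: x)) ^+ 2 =
  (nrm (y - (complex.Re z)%:C *: x)) ^+ 2 + (complex.Im z) ^+ 2 * (nrm x) ^+ 2.
Proof.
move=> h; set a := complex.Re z; set b := complex.Im z.
have -> : y - z *: x = (y - a%:C *: x) + (- (b *i)%C) *: x.
  rewrite scaleNr -addrA -opprD -scalerDl; congr (_ - _ *: _).
  by rewrite /a /b; case: (z) => p q; rewrite /real_complex_def; simpc.
rewrite (nrm_sqrD hH) nrmZ cabsN cabs_iM exprMn real_normK ?num_real//.
suff -> : complex.Re (ip (y - a%:C *: x) (- (b *i)%C *: x)) = 0 by rewrite mulr0 addr0.
rewrite ipZr ipBl ipZl conj_rc (ipxx hH); have := graph_ip_real h.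
by case: (ip y x) => p q /= ->; ring.
Qed.

Lemma graph_nrm_ge z x y : A (x, y) -> `|complex.Im z| * nrm x <= nrm (y - z *: x).
Proof.
move=> h; rewrite -(@ler_pXn2r _ 2) ?nnegrE ?mulr_ge0 ?nrm_ge0//.
by rewrite (graph_nrm z h) exprMn real_normK ?num_real// lerDr sqr_ge0.
Qed.

Lemma graph_nrm_Re z x y : A (x, y) ->
  nrm (y - (complex.Re z)%:C *: x) <= nrm (y - z *: x).
Proof.
move=> h; rewrite -(@ler_pXn2r _ 2) ?nnegrE ?nrm_ge0//.
by rewrite (graph_nrm z h) lerDl mulr_ge0 ?sqr_ge0.
Qed.

Lemma graph_inj z x : complex.Im z != 0 -> A (x, z *: x) -> x = 0.
Proof.
move=> z0 /(graph_nrm_ge z); rewrite subrr nrm0 => h.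
apply/nrm_eq0/eqP; rewrite eq_le nrm_ge0 andbT.
by rewrite -(@ler_pM2l _ `|complex.Im z|) ?normr_gt0// mulr0.
Qed.

(** The range of A - z is dense, since a vector orthogonal to it is an eigenvector
for the conjugate of z, and closed, since A - z is bounded below. *)
Lemma range_full z h : complex.Im z != 0 -> exists x, A (x, h + z *: x).
Proof.
move=> z0; pose V : set H := [set v | exists x, A (x, v + z *: x)].
have VL a x y : V x -> V y -> V (a *: x + y).
  move=> [s hs] [t ht]; exists (a *: s + t).
  have := graph_lin a hs ht; congr (A (_, _)).
  by rewrite !scalerDr !scalerA [z * a]mulrC addrACA.
have V0 : V 0 by exists 0; rewrite scaler0 addr0; exact: graph0.
have [|||p [Vp _ hp]] := @riesz_subspace _ _ _ hH V (ip h) (nrm h) V0 VL.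
- by move=> a x y _ _; rewrite ipDr ipZr.
- by move=> x _; exact: CauchySchwarz.
- exact: nrm_ge0.
have ph : h = p.
  apply/eqP; rewrite -subr_eq0; apply/eqP.
  apply: (@graph_inj (Num.conj z)); first by case: (z) z0 => a b /=; rewrite oppr_eq0.
  apply: graph_adj => x y xy.
  have : V (y - z *: x) by exists x; rewrite subrK.
  move=> /hp; rewrite !ipBr !ipZr => /eqP e.
  by rewrite !ipBl ipZl conjCK ipBl; apply/eqP; rewrite -subr_eq0; move: e;
    rewrite -subr_eq0 => /eqP e; apply/eqP; rewrite -[RHS]oppr0 -e; ring.
have [u Vu up] := closure_tends Vp.
have /choice[s hs] n : exists s, A (s, u n + z *: s) by exact: Vu.
have [x sx] : exists x, tends s x.
  apply: cauchy_tends => e e0.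
  have b0 : 0 < `|complex.Im z| by rewrite normr_gt0.
  have e1 : 0 < `|complex.Im z| * e / 2 by rewrite divr_gt0// mulr_gt0.
  have [N hN] := up _ e1; exists N => m n hm hn.
  have := graph_nrm_ge z (graphB (hs m) (hs n)).
  have -> : u m + z *: s m - (u n + z *: s n) - z *: (s m - s n) = u m - u n.
    by rewrite opprD addrACA -scalerBr addrK.
  have := nrm_tri p (u m) (u n); rewrite (nrm_sub p (u n)).
  have := hN _ hm; have := hN _ hn => h1 h2 h3 h4.
  rewrite -(@ltr_pM2l _ `|complex.Im z|)//; lra.
exists x; apply: (graph_closed hs sx); rewrite ph.
by apply: tendsD => //; exact: tendsZ.
Qed.

(** (A - z)^-1 as a total function, meaningful for non-real z. *)
Definition Rz z h : H := xget 0 [set x | A (x, h + z *: x)].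

Lemma RzP z h : complex.Im z != 0 -> A (Rz z h, h + z *: Rz z h).
Proof.
by move=> z0; exact: (@xgetPex _ 0 [set x | A (x, h + z *: x)] (range_full h z0)).
Qed.

Lemma Rz_unique z h x : complex.Im z != 0 -> A (x, h + z *: x) -> x = Rz z h.
Proof.
move=> z0 hx; apply/eqP; rewrite -subr_eq0; apply/eqP.
apply: (graph_inj z0); have := graphB hx (RzP h z0); congr (A (_, _)).
by rewrite opprD addrACA subrr add0r scalerBr.
Qed.

Lemma Rz_lin z a h k : complex.Im z != 0 -> Rz z (a *: h + k) = a *: Rz z h + Rz z k.
Proof.
move=> z0; apply/esym/Rz_unique => //.
have := graph_lin a (RzP h z0) (RzP k z0); congr (A (_, _)).
by rewrite !scalerDr !scalerA [z * a]mulrC addrACA.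
Qed.

Lemma RzD z h k : complex.Im z != 0 -> Rz z (h + k) = Rz z h + Rz z k.
Proof. by move=> z0; rewrite -[h]scale1r Rz_lin// !scale1r. Qed.

Lemma Rz0 z : complex.Im z != 0 -> Rz z 0 = 0.
Proof.
move=> z0; apply/esym/Rz_unique => //; rewrite scaler0 addr0; exact: graph0.
Qed.

Lemma RzZ z a h : complex.Im z != 0 -> Rz z (a *: h) = a *: Rz z h.
Proof. by move=> z0; rewrite -[a *: h]addr0 Rz_lin// Rz0// addr0. Qed.

Lemma RzB z h k : complex.Im z != 0 -> Rz z (h - k) = Rz z h - Rz z k.
Proof. by move=> z0; rewrite -scaleN1r RzD// RzZ// scaleN1r. Qed.

Lemma Rz_graph z x y : complex.Im z != 0 -> A (x, y) -> Rz z (y - z *: x) = x.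
Proof. by move=> z0 xy; apply/esym/Rz_unique => //; rewrite subrK. Qed.

Lemma Rz_nrm z h : complex.Im z != 0 -> `|complex.Im z| * nrm (Rz z h) <= nrm h.
Proof. by move=> /(RzP h)/(graph_nrm_ge z); rewrite addrK. Qed.

Lemma Rz_nrm_Re z h : complex.Im z != 0 ->
  nrm (h + z *: Rz z h - (complex.Re z)%:C *: Rz z h) <= nrm h.
Proof. by move=> /(RzP h)/(graph_nrm_Re z); rewrite addrK. Qed.

Lemma resolvent_identity z w h : complex.Im z != 0 -> complex.Im w != 0 ->
  Rz z h = Rz w h + (z - w) *: Rz z (Rz w h).
Proof.
move=> z0 w0; apply/esym/Rz_unique => //.
have := graph_lin (z - w) (RzP (Rz w h) z0) (RzP h w0).
rewrite [X in A (X, _)]addrC; congr (A (_, _)).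
rewrite !scalerDr !scalerA addrC -!addrA; congr (_ + _).
by rewrite addrA -scalerDl [w + _]addrC subrK [(z - w) * z]mulrC.
Qed.

Lemma Rz_comm z w h : complex.Im z != 0 -> complex.Im w != 0 ->
  Rz z (Rz w h) = Rz w (Rz z h).
Proof.
move=> z0 w0; have [->//|zw] := eqVneq z w.
have zw0 : z - w != 0 by rewrite subr_eq0.
have e s t : complex.Im s != 0 -> complex.Im t != 0 ->
    Rz s h - Rz t h = (s - t) *: Rz s (Rz t h).
  by move=> s0 t0; apply/eqP; rewrite subr_eq addrC; apply/eqP/resolvent_identity.
by apply: (scalerI zw0); rewrite -e// -opprB e// -scaleNr opprB.
Qed.

Lemma Rz_comm_graph z x y : complex.Im z != 0 -> A (x, y) -> A (Rz z x, Rz z y).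
Proof.
move=> z0 xy; have -> : Rz z y = x + z *: Rz z x.
  by rewrite -{1}(Rz_graph z0 xy) RzB// RzZ// subrK.
exact: RzP.
Qed.

Lemma Im_conj_neq0 z : complex.Im z != 0 -> complex.Im (Num.conj z) != 0.
Proof. by case: z => a b /=; rewrite oppr_eq0. Qed.

Lemma Rz_adj z h k : complex.Im z != 0 ->
  ip (Rz z h) k = ip h (Rz (Num.conj z) k).
Proof.
move=> z0; have z1 := Im_conj_neq0 z0.
have := graph_sym (RzP h z0) (RzP k z1).
by rewrite ipDr ipDl ipZl ipZr => /addIr.
Qed.

(** Yosida approximations of the identity: contractions that commute with A and map
H into D(A). *)
Definition yosida (n : nat) h : H := (- (n.+1%:R *i)%C) *: Rz (n.+1%:R *i)%C h.

Lemma Im_in (n : nat) : complex.Im ((n.+1%:R : R) *i)%C != 0.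
Proof. by rewrite /= pnatr_eq0. Qed.

Lemma yosida_nrm n h : nrm (yosida n h) <= nrm h.
Proof. by rewrite nrmZ cabsN cabs_iM; exact: Rz_nrm (Im_in n). Qed.

Lemma yosidaB n h k : yosida n (h - k) = yosida n h - yosida n k.
Proof. by rewrite /yosida RzB ?Im_in// scalerBr. Qed.

Lemma yosida_graph n x y : A (x, y) -> A (yosida n x, yosida n y).
Proof. by move=> xy; apply: graphZ; apply: Rz_comm_graph => //; exact: Im_in. Qed.

Lemma yosida_dom n h : exists y, A (yosida n h, y).
Proof. by eexists; apply: graphZ; apply: RzP; exact: Im_in. Qed.

Lemma yosida_tends h : tends (fun n => yosida n h) h.
Proof.
have dD : dense (op_dom A) by case: hA.
move=> e e0; have e3 : 0 < e / 3 by rewrite divr_gt0.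
have [x [y xy] hx] := denseE h dD e3.
have [N hN] := eventually_invS_lt (divr_gt0 e3 (ltr_wpDl (nrm_ge0 y) (@ltr01 R))).
exists N => n /hN; rewrite ltr_pdivlMr; last exact: ltr_wpDl (nrm_ge0 y) ltr01.
move=> hn.
have h1 : nrm (yosida n x - x) <= n.+1%:R^-1 * nrm y.
  have z0 := Im_in n; set z := (n.+1%:R *i)%C in z0 *.
  have -> : yosida n x - x = - Rz z y.
    by rewrite -{2}(Rz_graph z0 xy) RzB// RzZ// /yosida scaleNr opprB addKr.
  rewrite nrmN -[nrm (Rz z y)]mul1r ler_pdivlMl ?ltr0n// mul1r.
  have := Rz_nrm y z0; by rewrite /= ger0_norm.
have h2 := yosida_nrm n (x - h); rewrite yosidaB in h2.
have -> : yosida n h - h = (yosida n x - x) + (x - h) - (yosida n x - yosida n h).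
  by rewrite opprB [RHS]addrC !subrKA.
have := nrmB ((yosida n x - x) + (x - h)) (yosida n x - yosida n h).
have := nrmD (yosida n x - x) (x - h).
have i0 : 0 <= n.+1%:R^-1 :> R by rewrite invr_ge0.
rewrite mulrDr mulr1 in hn.
move: (n.+1%:R^-1) (nrm (yosida n x - x)) i0 h1 hn => i X i0 h1 hn.
have := nrm_ge0 y; lra.
Qed.

End SelfAdjoint.

(** * Domain of the modulus *)

Section Modulus.
Context {R : realType} {H : completeNormedModType R[i]}.
Context {dot : {dot H for Num.conj}}.
Context (hH : hilbert_norm dot).
Context {A B : set (H * H)}.
Context (hA : self_adjoint dot A).
Context (hB : is_modulus dot A B).
Local Notation ip := (inner dot).

(** |A x|^2 = <x, A^2 x> = <x, B^2 x> = |B x|^2 on the common domain of A^2 and B^2. *)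
Lemma modulus_same_nrm x y w t : A (x, y) -> A (y, w) -> B (x, t) -> B (t, w) ->
  nrm t = nrm y.
Proof.
case: hB => sB _ _ xy yw xt tw; apply/eqP.
rewrite -(@eqrXn2 _ 2) ?nrm_ge0//; apply/eqP/complexI; rewrite -!(ipxx hH).
by rewrite -(graph_sym hA xy yw) -(graph_sym sB xt tw).
Qed.

(** The domain of A^2 = B^2 is a core for A (by Yosida approximation), and A and B
have equal norms on it; so every x in D(A) is in the domain of the closed
operator B. *)
Lemma modulus_dom x y : A (x, y) -> exists2 t, B (x, t) & nrm t <= nrm y.
Proof.
move=> xy; case: (hB) => sB _ BBAA.
have /choice[w hw] n : exists w, A (@yosida _ _ A n y, w) by exact: (yosida_dom hH hA).
have xyn n : A (@yosida _ _ A n x, @yosida _ _ A n y) by exact: (yosida_graph hH hA).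
have /choice[t ht] n : exists t, B (@yosida _ _ A n x, t) /\ B (t, w n).
  have : op_comp (adjoint dot A) A (@yosida _ _ A n x, w n).
    exists (@yosida _ _ A n y); split; first exact: xyn.
    by case: hA => _ _ ->; exact: hw.
  by rewrite -BBAA.
have tn m n : nrm (t m - t n) = nrm (@yosida _ _ A m y - @yosida _ _ A n y).
  apply: modulus_same_nrm (graphB hA (xyn m) (xyn n)) (graphB hA (hw m) (hw n)) _ _.
    by apply: (graphB sB); [exact: (ht m).1|exact: (ht n).1].
  by apply: (graphB sB); [exact: (ht m).2|exact: (ht n).2].
have yy := yosida_tends hH hA y; have xx := yosida_tends hH hA x.
have [s ts] : exists s, tends t s.
  apply: cauchy_tends => e e0; have e2 : 0 < e / 2 by rewrite divr_gt0.
  have [N hN] := yy _ e2; exists N => m n hm hn; rewrite tn.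
  have := nrm_tri y (@yosida _ _ A m y) (@yosida _ _ A n y).
  rewrite (nrm_sub y (yosida _ _)); have := hN _ hm; have := hN _ hn; lra.
exists s; first by apply: (graph_closed hH sB) xx ts => n; exact: (ht n).1.
apply: tends_nrm_le ts _; exists 0%N => n _.
rewrite (modulus_same_nrm (xyn n) (hw n) (ht n).1 (ht n).2).
exact: (yosida_nrm hH hA).
Qed.

End Modulus.

(** Membership in H_{-2}, restated with A in place of its modulus; all later arguments
start from these two properties. *)
Lemma in_Hm2_bounded (R : realType) (H : completeNormedModType R[i])
  (dot : {dot H for Num.conj}) (hH : hilbert_norm dot) (A : set (H * H))
  (hA : self_adjoint dot A) (phi : H -> R[i]) : in_Hm2 dot A phi ->
  (forall a x y x' y', A (x, y) -> A (x', y') -> phi (a *: x + x') = a * phi x + phi x') /\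
  exists K : R, 0 <= K /\ forall x y, A (x, y) -> cabs (phi x) <= K * (nrm y + nrm x).
Proof.
case=> B [hB phiL [K hK]]; split.
  move=> a x y x' y' xy xy'; apply: phiL.
    by have [t] := modulus_dom hH hA hB xy; exists t.
  by have [t] := modulus_dom hH hA hB xy'; exists t.
exists `|K|; split => // x y xy; have [t xt ty] := modulus_dom hH hA hB xy.
have := hK _ _ xt; rewrite normCE nrmE -rcM lecR => h.
apply: le_trans h _; apply: le_trans (ler_wpM2r (nrm_ge0 _) (ler_norm K)) _.
by apply: ler_wpM2l => //; apply: le_trans (nrmD _ _) _; rewrite lerD2r.
Qed.

(** * Singular functionals and weak resolvents *)

Section SingularFunctional.
Context {R : realType} {H : completeNormedModType R[i]}.
Context {dot : {dot H for Num.conj}}.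
Context (hH : hilbert_norm dot).
Context {A : set (H * H)}.
Context (hA : self_adjoint dot A).
Context {phi : H -> R[i]}.
Context (phi_lin : forall a x y x' y', A (x, y) -> A (x', y') ->
  phi (a *: x + x') = a * phi x + phi x').
Local Notation ip := (inner dot).
Implicit Types (z w : R[i]) (E K : R).

Lemma phi0 : phi 0 = 0.
Proof.
have := phi_lin 1 (graph0 hA) (graph0 hA); rewrite scaler0 addr0 mul1r => /eqP.
by rewrite -subr_eq0 opprD addNKr oppr_eq0 => /eqP.
Qed.

Lemma phiZ a x y : A (x, y) -> phi (a *: x) = a * phi x.
Proof.
by move=> xy; rewrite -[_ *: _]addr0 (phi_lin _ xy (graph0 hA)) phi0 addr0.
Qed.

Lemma phiD x y x' y' : A (x, y) -> A (x', y') -> phi (x + x') = phi x + phi x'.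
Proof. by move=> xy xy'; rewrite -[x]scale1r (phi_lin _ xy xy') mul1r scale1r. Qed.

Lemma phiB x y x' y' : A (x, y) -> A (x', y') -> phi (x - x') = phi x - phi x'.
Proof.
move=> xy xy'; rewrite -scaleN1r (phiD xy (graphZ hA (-1) xy')).
by rewrite (phiZ _ xy') mulN1r.
Qed.

(** psi = (A - z)^-1 phi by duality. The definition makes sense for every z; for real
z such a psi may fail to exist. *)
Definition weak_resolvent z (psi : H) :=
  forall x y, A (x, y) -> ip psi (y - Num.conj z *: x) = phi x.

Lemma weak_resolvent_ip z psi x y : weak_resolvent z psi -> A (x, y) -> ip psi y = phi x + ip (z *: psi) x.
Proof. by move=> h /h; rewrite ipBr ipZr ipZl => <-; rewrite subrK. Qed.

(** The two copies of phi cancel when p - q is paired with A x, so p - q belongs to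
the domain of the adjoint of A, which is A. *)
Lemma weak_resolvent_diff z p w q : weak_resolvent z p -> weak_resolvent w q -> A (p - q, z *: p - w *: q).
Proof.
move=> hp hq; apply: (graph_adj hA) => x y xy.
by rewrite !ipBl (weak_resolvent_ip hp xy) (weak_resolvent_ip hq xy) opprD addrACA subrr add0r.
Qed.

(** Formally <phi, p - q> = <(A - E') q, p - q> = <q, (A - E') (p - q)>, where
(A - E') (p - q) = (E - E') p because (A - E) p = (A - E') q = phi. *)
Lemma phi_weak_resolvent_diff E p E' q : weak_resolvent E%:C p -> weak_resolvent E'%:C q ->
  phi (p - q) = (E - E')%:C * ip q p.
Proof.
move=> hp hq; rewrite -(hq _ _ (weak_resolvent_diff hp hq)) conj_rc -ipZr; congr (ip q _).
by rewrite scalerBr opprB addrA subrK -scalerBl rcB.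
Qed.

Lemma weak_resolvent_shift z w psi : weak_resolvent w psi -> complex.Im z != 0 ->
  weak_resolvent z (psi + (z - w) *: Rz (A := A) z psi).
Proof.
move=> hw z0 x y xy; rewrite ipDl ipZl (Rz_adj hH hA)//.
rewrite (Rz_graph hH hA (Im_conj_neq0 z0) xy) -(hw _ _ xy) -ipZl !ipBr !ipZr ipZl.
by rewrite rmorphB /=; ring.
Qed.

Lemma weak_resolvent_unique z p q : complex.Im z != 0 -> weak_resolvent z p -> weak_resolvent z q -> p = q.
Proof.
move=> z0 hp hq; apply/eqP; rewrite -subr_eq0; apply/eqP.
by apply: (graph_inj hH hA z0); have := weak_resolvent_diff hp hq; rewrite scalerBr.
Qed.

Section GenResolvent.
Context (phi_bd : exists K, 0 <= K /\
  forall x y, A (x, y) -> cabs (phi x) <= K * (nrm y + nrm x)).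

(** phi o (A - conj z)^-1 is a bounded functional on H, so the Riesz theorem provides
the vector that [gen_resolvent] selects. *)
Lemma gen_resolventP z : complex.Im z != 0 -> weak_resolvent z (gen_resolvent dot A phi z).
Proof.
move=> z0; have [K [K0 hK]] := phi_bd; have z1 := Im_conj_neq0 z0.
have RP h := RzP hH hA h z1.
set S : set H := [set u : H | forall eta x : H,
    resolvent A (Num.conj z) (eta, x) -> inner dot u eta = phi x].
suff : exists u, S u.
  move=> /(@xgetPex _ 0 S) h x y xy; apply: (h); rewrite /resolvent /=.
  by rewrite subrK.
pose b := `|complex.Im (Num.conj z)|; have b0 : 0 < b by rewrite normr_gt0.
pose L := K * (1 + (cabs z + 1) / b).
have L0 : 0 <= L by rewrite mulr_ge0// addr_ge0// divr_ge0 ?(ltW b0)// addr_ge0// cabs_ge0.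
have [||||p [_ _ hp]] := @riesz_subspace _ _ _ hH setT
    (fun h => phi (Rz (A := A) (Num.conj z) h)) L _ _ _ _ L0 => //.
- by move=> a x y _ _; rewrite (Rz_lin hH hA)// (phi_lin _ (RP x) (RP y)).
- move=> h _; apply: le_trans (hK _ _ (RP h)) _.
  rewrite /L -mulrA ler_wpM2l//.
  have h1 : nrm (Rz (A := A) (Num.conj z) h) <= nrm h / b.
    by rewrite ler_pdivlMr// mulrC; exact: (Rz_nrm hH hA).
  have h2 := nrmD h (Num.conj z *: Rz (A := A) (Num.conj z) h).
  rewrite nrmZ cabsJ in h2.
  have -> : (1 + (cabs z + 1) / b) * nrm h = nrm h + (cabs z + 1) * (nrm h / b) by ring.
  have := cabs_ge0 z; move: (nrm h / b) (nrm (Rz _ h)) h1 h2 => r s; nra.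
exists p => eta x hx; rewrite hp//; congr phi.
by apply/esym; apply: (Rz_unique hH hA).
Qed.

Lemma Im_i : complex.Im ('i : R[i]) != 0.
Proof. by rewrite -complexiE oner_eq0. Qed.

Lemma Im_Ni : complex.Im (- 'i : R[i]) != 0.
Proof. by rewrite -complexiE /= oppr_eq0 oner_eq0. Qed.

Local Notation g := (defect_vec dot A phi).

Lemma weak_resolvent_defect z psi : weak_resolvent z psi -> exists y, A (psi - g, y).
Proof.
move=> hp; have h1 := weak_resolvent_diff hp (gen_resolventP Im_i).
have h2 := weak_resolvent_diff hp (gen_resolventP Im_Ni).
eexists; rewrite (_ : psi - g = 2%:R^-1 *:
  ((psi - gen_resolvent dot A phi 'i) + (psi - gen_resolvent dot A phi (- 'i)))).
  have h3 := graphZ hA (2%:R^-1) (graphD hA h1 h2); exact: h3.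
rewrite /defect_vec addrACA -opprD scalerBr; congr (_ - _).
by rewrite -[psi + psi]mulr2n -[psi *+ 2]scaler_nat scalerA mulVf ?scale1r// pnatr_eq0.
Qed.

(** Vectors of D(A_dot) are annihilated by phi and g is in the domain of the adjoint
of A_dot, so <g, A x> is a multiple of phi up to an H-bounded functional; the
factor is 1. *)
Lemma defect_ip : exists k, forall x y, A (x, y) -> ip g y = phi x + ip k x.
Proof.
exists (2%:R^-1 *: ('i *: gen_resolvent dot A phi 'i +
                   (- 'i) *: gen_resolvent dot A phi (- 'i))) => x y xy.
rewrite /defect_vec !ipZl ipDl (weak_resolvent_ip (gen_resolventP Im_i) xy).
rewrite (weak_resolvent_ip (gen_resolventP Im_Ni) xy) ipDl.
have -> : Num.conj (2%:R^-1) = 2%:R^-1 :> R[i] by rewrite fmorphV rmorph_nat.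
have n2 : 2%:R != 0 :> R[i] by rewrite pnatr_eq0.
by field.
Qed.

Context (phiH : ~ in_H dot A phi).

Lemma phi_neq0 : exists x y, A (x, y) /\ phi x != 0.
Proof.
apply: contrapT => h; apply: phiH; exists 0 => x [y xy]; rewrite ip0l.
by apply/eqP/negP => /negP p0; apply: h; exists x, y.
Qed.

(** Both sides vanish where phi does, hence are multiples of phi. The factor is found
modulo H-bounded functionals: <x1, (A - E) x> is bounded, b <g, A x> contributes
conj b * phi x, and phi itself is not bounded. *)
Lemma adjoint_A_dot_ip E x1 y1 b : A (x1, y1) ->
  let v := x1 + b *: g in
  adjoint dot (A_dot A phi) (v, E%:C *: v) ->
  forall x y, A (x, y) -> ip v (y - E%:C *: x) = Num.conj b * phi x.
Proof.
move=> xy1; case: defect_ip; move: (g) => d k hk v hv.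
have [x0 [y0 [xy0 p0]]] := phi_neq0.
pose l x y := ip v (y - E%:C *: x).
have lZ a x y x' y' : l (a *: x + x') (a *: y + y') = a * l x y + l x' y'.
  rewrite /l -ipZr -ipDr; congr (ip v _).
  by rewrite !scalerBr scalerDr !scalerA [_ * a]mulrC opprD addrACA.
have l0 x y : A (x, y) -> phi x = 0 -> l x y = 0.
  move=> xy px; have /hv /= e : A_dot A phi (x, y) by [].
  by rewrite /l ipBr ipZr e ipZl conj_rc subrr.
pose kap := l x0 y0 / phi x0.
have lk x y : A (x, y) -> l x y = kap * phi x.
  move=> xy; have xy' := graph_lin hA (- (phi x / phi x0)) xy0 xy.
  have := l0 _ _ xy'; rewrite (phi_lin _ xy0 xy) mulNr divfK// addNr => /(_ erefl).
  rewrite lZ => /eqP; rewrite addrC mulNr subr_eq0 => /eqP ->; rewrite /kap.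
  by ring.
pose h := (y1 - E%:C *: x1) + b *: (k - E%:C *: d).
have lh x y : A (x, y) -> l x y = Num.conj b * phi x + ip h x.
  move=> xy; rewrite /l /v /h !(ipDl, ipNl, ipZl, ipBr, ipZr) !conj_rc.
  by rewrite (hk _ _ xy) (graph_sym hA xy1 xy); ring.
have [kb|kb] := eqVneq kap (Num.conj b).
  by move=> x y xy; rewrite -/(l x y) lk// kb.
exfalso; apply: phiH; exists (Num.conj ((kap - Num.conj b)^-1) *: h) => x [y xy].
have e := lh _ _ xy; rewrite lk// in e.
have kb0 : kap - Num.conj b != 0 by rewrite subr_eq0.
rewrite ipZl conjCK; apply: (mulfI kb0); rewrite mulVKf// mulrBl e; ring.
Qed.

(** If phi v = 0, then v is orthogonal to (A - i)^-1 phi, hence to every vector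
(A - z)^-1 (A - i)^-1 phi, because v is an eigenvector of the adjoint resolvent. *)
Lemma cyclicity_eigenvector E v :
  A (v, E%:C *: v) -> phi v = 0 ->
  cyclicity_space A (gen_resolvent dot A phi 'i) v -> v = 0.
Proof.
set u := gen_resolvent dot A phi 'i => hv pv Mv.
have Ez0 z : complex.Im z != 0 -> E%:C - z != 0.
  by case: z => a b /= b0; rewrite eq_complex /= sub0r oppr_eq0 (negPf b0) andbF.
have uv : ip u v = 0.
  have := gen_resolventP Im_i hv; rewrite -/u pv -scalerBl ipZr => /eqP.
  by rewrite mulf_eq0 (negPf (Ez0 _ (Im_conj_neq0 Im_i))) => /eqP.
have Rv z : complex.Im z != 0 -> ip (Rz (A := A) z u) v = 0.
  move=> z0; have z1 := Im_conj_neq0 z0; rewrite (Rz_adj hH hA)//.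
  have := Rz_graph hH hA z1 hv; rewrite -scalerBl (RzZ hH hA)// => e.
  by apply: (mulfI (Ez0 _ z1)); rewrite -ipZr e uv mulr0.
have Sv s : lin_span [set x | exists z : R[i], complex.Im z != 0 /\ resolvent A z (u, x)] s ->
    ip s v = 0.
  move=> [n [a [w [hw ->]]]]; rewrite ip_suml big1// => k _; rewrite ipZl.
  have [z [z0 /(Rz_unique hH hA z0) /= ->]] := hw k.
  by rewrite Rv// mulr0.
apply: nrm_eq0; apply/eqP; rewrite eq_le nrm_ge0 andbT.
apply: (@le_of_eps _ _ _ 1) => // e e0; rewrite add0r mul1r.
have /closureE /(_ _ e0)[s Ss hs] := Mv.
have h1 : (nrm v) ^+ 2 = complex.Re (ip (v - s) v).
  by rewrite ipBl (Sv _ Ss) subr0 (ipxx hH).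
have h2 := Re_le_cabs (ip (v - s) v); have h3 := CauchySchwarz hH (v - s) v.
rewrite (nrm_sub v) in h3; have := nrm_ge0 v; have := nrm_ge0 (s - v); nra.
Qed.

(** Here b <> 0: otherwise v would be an eigenvector of A in M annihilated by phi.
After division by b, [adjoint_A_dot_ip] identifies v as (A - E)^-1 phi. *)
Lemma eigenvector_weak_resolvent c alpha E v :
  alpha != 0 -> v != 0 -> A_pert dot A phi c alpha (v, E%:C *: v) ->
  cyclicity_space A (gen_resolvent dot A phi 'i) v ->
  exists psi, weak_resolvent E%:C psi /\ alpha * (complex.Re (phi (psi - g)) + c) = -1.
Proof.
move=> al0 v0 [/= vadj [x1 [b [[y1 xy1] ev]]]]; rewrite /phi_ext => hb Mv.
rewrite ev in vadj.
have hv := adjoint_A_dot_ip xy1 vadj; rewrite -ev in hv.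
have [b0|b0] := eqVneq b 0.
  exfalso; move/eqP: v0; apply.
  apply: (@cyclicity_eigenvector E) => //.
    apply: (graph_adj hA) => x y xy; have := hv _ _ xy; rewrite b0 rmorph0 mul0r.
    by rewrite ipBr ipZr ipZl conj_rc => /eqP; rewrite subr_eq0 => /eqP.
  move: hb; rewrite ev b0 scale0r addr0 mul0r add0r addr0 => /eqP.
  rewrite mulf_eq0 -[0]/(0%:C) (inj_eq (@complexI R)) (negPf al0) /= => /eqP.
  by [].
exists (b^-1 *: v); split.
  move=> x y xy; rewrite conj_rc ipZl hv// fmorphV mulKf// fmorph_eq0//.
have -> : b^-1 *: v - g = b^-1 *: x1.
  by rewrite ev scalerDr scalerA mulVf// scale1r addrK.
rewrite (phiZ _ xy1).
have : alpha%:C * (b^-1 * phi x1 + c%:C) = -1.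
  apply: (mulfI b0); rewrite mulrN1; apply/eqP; rewrite -addr_eq0 -hb; apply/eqP.
  by field.
move=> /(congr1 (@complex.Re R)); rewrite ReZ ReD /= => ->.
done.
Qed.

Lemma gen_resolvent_Rz z : complex.Im z != 0 ->
  gen_resolvent dot A phi z = gen_resolvent dot A phi 'i +
    (z - 'i) *: Rz (A := A) z (gen_resolvent dot A phi 'i).
Proof.
move=> z0; apply: weak_resolvent_unique (z0) (gen_resolventP z0) _.
exact: weak_resolvent_shift (gen_resolventP Im_i) z0.
Qed.

(** By the Riesz theorem this is the existence of (A - E)^-1 phi with norm at most K,
expressed without choosing a vector. *)
Definition regular K E := forall x y, A (x, y) ->
  cabs (phi x) <= K * nrm (y - E%:C *: x).

Lemma weak_resolvent_regular K E psi : weak_resolvent E%:C psi -> nrm psi <= K -> regular K E.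
Proof.
move=> hp pK x y xy; rewrite -(hp _ _ xy) conj_rc.
by apply: le_trans (CauchySchwarz hH _ _) _; rewrite ler_wpM2r ?nrm_ge0.
Qed.

(** Riesz representation of (A - E) x |-> phi x on the range of A - E. That psi lies
in the closure of this range is what makes the pairing with psi weakly
continuous in [coupling_slope]. *)
Lemma regular_weak_resolvent K E : 0 <= K -> regular K E ->
  exists psi, [/\ weak_resolvent E%:C psi, nrm psi <= K &
    closure [set v | exists x, A (x, v + E%:C *: x)] psi].
Proof.
move=> K0 hK; set V := [set v | exists x, A (x, v + E%:C *: x)].
pose f v := phi (xget 0 [set x | A (x, v + E%:C *: x)]).
have fE v x : A (x, v + E%:C *: x) -> f v = phi x.
  move=> hx; rewrite /f.
  have := @xgetPex _ 0 [set x | A (x, v + E%:C *: x)] (ex_intro _ x hx).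
  set x' := xget _ _ => /= hx'; apply/eqP; rewrite -subr_eq0; apply/eqP/cabs_eq0/eqP.
  rewrite eq_le cabs_ge0 andbT -(phiB hx' hx).
  apply: le_trans (hK _ _ (graphB hA hx' hx)) _.
  by rewrite opprD addrACA subrr add0r -scalerBr subrr nrm0 mulr0.
have lin a (x y v t : H) : A (x, v + E%:C *: x) -> A (y, t + E%:C *: y) ->
    A (a *: x + y, a *: v + t + E%:C *: (a *: x + y)).
  move=> hx hy; have := graph_lin hA a hx hy; congr (A (_, _)).
  by rewrite !scalerDr !scalerA [_ * a]mulrC addrACA.
have [||||p [Vp pK hp]] := @riesz_subspace _ _ _ hH V f K _ _ _ _ K0.
- by exists 0; rewrite scaler0 addr0; exact: (graph0 hA).
- by move=> a v t [x hx] [y hy]; exists (a *: x + y); exact: lin.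
- move=> a v t [x hx] [y hy].
  by rewrite (fE _ _ hx) (fE _ _ hy) (fE _ _ (lin a _ _ _ _ hx hy)) (phi_lin _ hx hy).
- move=> v [x hx]; rewrite (fE _ _ hx); apply: le_trans (hK _ _ hx) _.
  by rewrite addrK.
exists p; split => // x y xy; rewrite conj_rc hp; last by exists x; rewrite subrK.
by apply: fE; rewrite subrK.
Qed.

Lemma regular_ge0 K E : regular K E -> 0 <= K.
Proof.
have [x [y [xy px]]] := phi_neq0.
move=> /(_ _ _ xy)/(lt_le_trans (cabs_gt0 px)) h.
by rewrite leNgt; apply/negP => Kn; move: h; rewrite ltNge mulr_le0_ge0 ?nrm_ge0// ltW.
Qed.

(** Moving from E to E + i eps does not increase the norm of (A - E)^-1 phi, because
(A - E) (A - E - i eps)^-1 is a contraction. *)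
Lemma regular_gen_resolvent K z : complex.Im z != 0 -> regular K (complex.Re z) ->
  nrm (gen_resolvent dot A phi z) <= K.
Proof.
move=> z0 hK; have K0 := regular_ge0 hK.
set u := gen_resolvent dot A phi z; have z1 := Im_conj_neq0 z0.
have hR := RzP hH hA u z1.
have h1 : (nrm u) ^+ 2 <= K * nrm u.
  have -> : (nrm u) ^+ 2 = complex.Re (phi (Rz (A := A) (Num.conj z) u)).
    by rewrite -(gen_resolventP z0 hR) addrK (ipxx hH).
  apply: le_trans (Re_le_cabs _) _.
  have := hK _ _ hR; have := Rz_nrm_Re hH hA u z1; rewrite Re_conj => e1 e2.
  by apply: le_trans e2 _; rewrite ler_wpM2l.
have [->|u0] := eqVneq (nrm u) 0; first by [].
by rewrite expr2 ler_pM2r // in h1; rewrite lt_neqAle eq_sym u0 nrm_ge0.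
Qed.

End GenResolvent.
End SingularFunctional.

(** * Category on the real line *)

Section RealLine.
Context {R : realType}.
Implicit Types (Q K S : set R) (f : R -> R).

Definition empty_interior S := forall a b, a < b -> exists2 t, a < t < b & ~ S t.

Lemma closed_eps S :
  (forall x, (forall e, 0 < e -> exists2 y, S y & `|y - x| < e) -> S x) -> closed S.
Proof.
move=> h x Sx; apply: h => e e0.
have /Sx[y [Sy]] : nbhs x (ball x e) by exact: nbhsx_ballx.
by rewrite /ball /= distrC => hy; exists y.
Qed.

Lemma closed_sup S : closed S -> has_sup S -> S (sup S).
Proof.
move=> cS hS; apply: contrapT => nS.
have /nbhs_ballP[e /= e0 he] : nbhs (sup S) (~` S).
  by apply: open_nbhs_nbhs; split => //; exact: closed_openC.
have [x Sx hx] := sup_adherent e0 hS.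
apply: (he x) => //; rewrite /ball /= ger0_norm ?ltrBlDr -?ltrBlDl//.
by rewrite subr_ge0; apply: ub_le_sup => //; exact: hS.2.
Qed.

Lemma closed_inf S : closed S -> has_inf S -> S (inf S).
Proof.
move=> cS hS; apply: contrapT => nS.
have /nbhs_ballP[e /= e0 he] : nbhs (inf S) (~` S).
  by apply: open_nbhs_nbhs; split => //; exact: closed_openC.
have [x Sx hx] := inf_adherent e0 hS.
apply: (he x) => //; rewrite /ball /= distrC ger0_norm ?ltrBlDl//.
by rewrite subr_ge0; apply: ge_inf => //; exact: hS.2.
Qed.

Lemma closed_image_lip Q f (L a b : R) : closed Q -> Q `<=` [set` `[a, b]] ->
  (forall x y, Q x -> Q y -> `|f x - f y| <= L * `|x - y|) -> closed (f @` Q).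
Proof.
move=> cQ Qab hL; apply: compact_closed; first exact: Rhausdorff.
apply: continuous_compact; last first.
  by apply: subclosed_compact Qab => //; exact: segment_compact.
apply/subspace_continuousP => x Qx; apply/cvgrPdist_lt => e e0.
have L1 : 0 < `|L| + 1 by rewrite ltr_wpDl.
near=> y.
have Qy : Q y by near: y; exact: withinT.
apply: le_lt_trans (hL _ _ Qx Qy) _.
apply: (@le_lt_trans _ _ ((`|L| + 1) * `|x - y|)).
  by rewrite ler_wpM2r// (le_trans (ler_norm L))// lerDl.
rewrite mulrC -ltr_pdivlMr//.
near: y; apply: cvg_within; apply: nbhsx_ballx; exact: divr_gt0.
Unshelve. all: by end_near.
Qed.

(** Two points x < y of Q are separated by some e outside Q; let p and q be the points
of Q nearest to e on either side. By monotonicity f takes no value on Q strictly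
between f p and f q. *)
Lemma increasing_image_empty_interior Q f : closed Q -> empty_interior Q ->
  (forall x y, Q x -> Q y -> x < y -> f x < f y) -> empty_interior (f @` Q).
Proof.
move=> cQ eQ hf a b ab; apply: contrapT => h.
have im t : a < t < b -> exists2 x, Q x & f x = t.
  by move=> tab; apply: contrapT => ht; apply: h; exists t.
have hfi x y : Q x -> Q y -> f x < f y -> x < y.
  move=> Qx Qy; case: (ltgtP x y) => [//|yx|->]; last by rewrite ltxx.
  by move=> /lt_trans /(_ (hf _ _ Qy Qx yx)); rewrite ltxx.
have [|x Qx fx] := im (a + (b - a) / 3); first by apply/andP; split; lra.
have [|y Qy fy] := im (a + (b - a) * 2 / 3); first by apply/andP; split; lra.
have xy : x < y by apply: hfi => //; rewrite fx fy; lra.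
have [e /andP[xe ey] nQe] := eQ _ _ xy.
pose P1 := Q `&` [set t | t <= e]; pose P2 := Q `&` [set t | e <= t].
have c1 : closed P1 by apply: closedI => //; exact: closed_le.
have c2 : closed P2 by apply: closedI => //; exact: closed_ge.
have s1 : has_sup P1.
  by split; [exists x; split => //=; exact: ltW|exists e => t []].
have s2 : has_inf P2.
  by split; [exists y; split => //=; exact: ltW|exists e => t []].
have [Qp /= pe] := closed_sup c1 s1; have [Qq /= eq] := closed_inf c2 s2.
set p := sup P1 in Qp pe; set q := inf P2 in Qq eq.
have xp : x <= p by apply: ub_le_sup; [exact: s1.2|split => //=; exact: ltW].
have qy : q <= y by apply: ge_inf; [exact: s2.2|split => //=; exact: ltW].
have pq : p < q.
  rewrite lt_neqAle (le_trans pe eq) andbT; apply/negP => /eqP pq.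
  by apply: nQe; have -> : e = p by apply/eqP; rewrite eq_le pe andbT pq.
have hfle s t : Q s -> Q t -> s <= t -> f s <= f t.
  by move=> Qs Qt; rewrite le_eqVlt => /orP[/eqP->//|/(hf _ _ Qs Qt)/ltW].
have fpq := hf _ _ Qp Qq pq.
have fxp := hfle _ _ Qx Qp xp; have fqy := hfle _ _ Qq Qy qy.
have [|m Qm fm] := im ((f p + f q) / 2); first by apply/andP; split; lra.
have [me|em] := leP m e.
  have mp : m <= p by apply: ub_le_sup; [exact: s1.2|].
  have := hfle _ _ Qm Qp mp; lra.
have qm : q <= m by apply: ge_inf; [exact: s2.2|split => //=; exact: ltW].
have := hfle _ _ Qq Qm qm; lra.
Qed.

(** The map a |-> - 1/a - c is a homeomorphism from the nonzero reals onto the line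
without - c, so preimages of dense open sets are dense and open. *)
Lemma generic_parameters (K : nat -> set R) (c : R) :
  (forall i, closed (K i)) -> (forall i, empty_interior (K i)) ->
  exists G : set R, [/\ Gdelta G, dense G &
    forall a, G a -> a != 0 /\ forall i, ~ K i (- a^-1 - c)].
Proof.
move=> cK eK.
pose U i : set R := [set a | a != 0 /\ ~ K i (- a^-1 - c)].
have oU i : open (U i).
  rewrite openE => a [a0 Ka].
  have h : - t^-1 - c @[t --> a] --> - a^-1 - c.
    by apply: cvgB; [apply: cvgN; exact: cvgV|exact: cvg_cst].
  have h1 : \forall t \near a, (~` K i) (- t^-1 - c).
    by apply: h; apply: open_nbhs_nbhs; split => //; exact: closed_openC.
  have h2 : \forall t \near a, t != 0.
    by apply: open_nbhs_nbhs; split => //; exact: open_neq.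
  by near=> t; split; near: t.
have dU i : dense (U i).
  move=> O [a0 Oa0] oO.
  have [a Oa az] : exists2 a, O a & a != 0.
    have [a00|] := eqVneq a0 0; last by exists a0.
    have /nbhs_ballP[e /= e0 he] : nbhs a0 O by apply: open_nbhs_nbhs.
    exists (e / 2); last by rewrite gt_eqF// divr_gt0.
    by apply: he; rewrite /ball /= a00 sub0r normrN ger0_norm ?divr_ge0 ?(ltW e0)//; lra.
  set t0 := - a^-1 - c.
  have at0 : - (t0 + c)^-1 = a by rewrite /t0 subrK invrN opprK invrK.
  have tc0 : t0 + c != 0 by rewrite /t0 subrK oppr_eq0 invr_eq0.
  have h : - (t + c)^-1 @[t --> t0] --> - (t0 + c)^-1.
    by apply: cvgN; apply: cvgV => //; apply: cvgD; [exact: cvg_id|exact: cvg_cst].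
  have h1 : \forall t \near t0, O (- (t + c)^-1).
    by apply: h; apply: open_nbhs_nbhs; rewrite at0.
  have h2 : \forall t \near t0, t + c != 0.
    have : t + c @[t --> t0] --> t0 + c by apply: cvgD; [exact: cvg_id|exact: cvg_cst].
    by move=> h3; apply: (h3 [set s | s != 0]); apply: open_nbhs_nbhs; split.
  have /nbhs_ballP[e /= e0 he] :
      nbhs t0 ([set t | O (- (t + c)^-1)] `&` [set t | t + c != 0]).
    exact: filterI.
  have [|t /andP[t1 t2] Kt] := eK i (t0 - e) (t0 + e); first lra.
  have [Ot tc] : O (- (t + c)^-1) /\ t + c != 0.
    by apply: he; rewrite /ball /= ltr_norml; apply/andP; split; lra.
  exists (- (t + c)^-1); split => //; split.
    by rewrite oppr_eq0 invr_eq0.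
  by rewrite invrN invrK opprK addrK.
exists (\bigcap_i U i); split.
- by exists U.
- by apply: (@Baire R R^o) => i; split; [exact: oU|exact: dU].
- move=> a Ga; split; first by have [] := Ga 0%N I.
  by move=> i; have [] := Ga i I.
Unshelve. all: by end_near.
Qed.

End RealLine.

(** * Polynomials positive on the real line *)

Section PositivePolynomials.
Context {R : realType}.
Implicit Types (p q f s : {poly R[i]}).

Definition conj_poly p := map_poly Num.conj p.

Lemma conj_polyM p q : conj_poly (p * q) = conj_poly p * conj_poly q.
Proof. exact: rmorphM. Qed.

Lemma conj_polyK p : conj_poly (conj_poly p) = p.
Proof. by apply/polyP => i; rewrite !coef_map /= conjCK. Qed.

Lemma conj_poly_XsubC z : conj_poly ('X - z%:P) = 'X - (Num.conj z)%:P.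
Proof. by rewrite /conj_poly rmorphB /= map_polyX map_polyC. Qed.

Lemma size_conj_poly p : size (conj_poly p) = size p.
Proof. exact: size_map_poly. Qed.

Lemma conj_poly_real p (x : R) : (conj_poly p).[x%:C] = Num.conj p.[x%:C].
Proof. by rewrite -{1}(conj_rc x) horner_map. Qed.

Lemma conj_polyM_real p (x : R) : (conj_poly p * p).[x%:C] = ((cabs p.[x%:C]) ^+ 2)%:C.
Proof. by rewrite hornerM conj_poly_real mulrC normCJ. Qed.

Lemma XsubC_mul_neq0 (z z' : R[i]) : ('X - z%:P) * ('X - z'%:P) != 0 :> {poly R[i]}.
Proof. by rewrite mulf_neq0// polyXsubC_eq0. Qed.

(** No root is real, so the roots come in conjugate pairs; s collects one from each. *)
Lemma positive_poly_factor f : conj_poly f = f -> (forall x : R, 0 < f.[x%:C]) ->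
  exists s, f = conj_poly s * s.
Proof.
move: {2}(size f) (leqnn (size f)) => n.
elim/ltn_ind: n f => n IH f sf cf pf.
have [sf1|sf1] := eqVneq (size f) 1%N.
  have [c c0 fc] := size_poly1P _ (introT eqP sf1).
  have cp : 0 < c by have := pf 0; rewrite fc hornerC.
  exists (sqrtC c)%:P; rewrite fc /conj_poly map_polyC /= -polyCM.
  by rewrite conj_Creal ?ger0_real ?sqrtC_ge0 ?ltW// -expr2 sqrtCK.
have [z rz] := closed_rootP f sf1.
have zr (x : R) : z != x%:C.
  by apply: contraTneq rz => ->; rewrite /root gt_eqF.
have zc : Num.conj z != z.
  case: (z) zr => a b zr; apply/eqP => -[/eqP]; rewrite eq_sym -subr_eq0 opprK.
  by rewrite -mulr2n mulrn_eq0 /= => b0; have := zr a; rewrite eq_complex /= eqxx b0.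
have [g fg] := factor_theorem f z rz.
have rg : root g (Num.conj z).
  have : root f (Num.conj z) by rewrite /root -{1}cf horner_map (rootP rz) rmorph0.
  by rewrite fg rootM => /orP[//|]; rewrite root_XsubC (negPf zc).
have [h gh] := factor_theorem g _ rg.
have fh : f = h * (('X - (Num.conj z)%:P) * ('X - z%:P)) by rewrite fg gh mulrA.
have h0 : h != 0.
  by apply/negP => /eqP h0; have := pf 0; rewrite fh h0 mul0r horner0 ltxx.
have [||||s hs] := IH (size h) _ h.
- apply: leq_trans sf; rewrite fh size_mul ?XsubC_mul_neq0//.
  by rewrite size_mul ?polyXsubC_eq0// !size_XsubC addn3.
- by [].
- apply: (mulIf (XsubC_mul_neq0 (Num.conj z) z)); rewrite -fh -[RHS]cf fh !conj_polyM.
  by rewrite !conj_poly_XsubC conjCK; congr (_ * _); rewrite mulrC.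
- move=> x; have := pf x; rewrite fh hornerM -conj_poly_XsubC conj_polyM_real.
  rewrite pmulr_lgt0// ltcR exprn_gt0// cabs_gt0// hornerXsubC subr_eq0 eq_sym.
  exact: zr.
exists (s * ('X - z%:P)); rewrite fh hs conj_polyM conj_poly_XsubC; ring.
Qed.

End PositivePolynomials.

Section SequenceEvaluation.
Context {K : fieldType} {V : lmodType K}.
Implicit Types (p q : {poly K}) (a : nat -> V).

(** The linear map that sends 'X^k to a k. When a k = A^k a0, it evaluates polynomials
at A on the vector a0. *)
Definition seq_eval a p := \sum_(k < size p) p`_k *: a k.

Lemma seq_eval_widen a p m : (size p <= m)%N -> seq_eval a p = \sum_(k < m) p`_k *: a k.
Proof.
move=> pm; rewrite /seq_eval (big_ord_widen _ (fun k => p`_k *: a k) pm) big_mkcond /=.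
by apply: eq_bigr => k _; case: ltnP => // pk; rewrite nth_default// scale0r.
Qed.

Lemma seq_eval_lin a (c : K) p q : seq_eval a (c *: p + q) = c *: seq_eval a p + seq_eval a q.
Proof.
set m := maxn (size p) (size q).
have h1 : (size (c *: p + q)%R <= m)%N.
  by apply: leq_trans (size_polyD _ _) _; rewrite geq_max leq_maxr andbT
    (leq_trans (size_scale_leq _ _))// leq_maxl.
rewrite (seq_eval_widen a h1) (seq_eval_widen a (leq_maxl _ _ : (size p <= m)%N)).
rewrite (seq_eval_widen a (leq_maxr _ _ : (size q <= m)%N)) scaler_sumr -big_split /=.
by apply: eq_bigr => k _; rewrite coefD coefZ scalerDl scalerA.
Qed.

HB.instance Definition _ a := GRing.isLinear.Build K {poly K} V *:%R (seq_eval a) (seq_eval_lin a).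

Lemma seq_eval1 a : seq_eval a 1 = a 0%N.
Proof. by rewrite /seq_eval size_poly1 big_ord1 coef1 scale1r. Qed.

Lemma seq_eval_Xn a n : seq_eval a 'X^n = a n.
Proof.
rewrite /seq_eval size_polyXn (bigD1 ord_max)//= coefXn eqxx scale1r big1 ?addr0// => k kn.
by rewrite coefXn (_ : (_ == _) = false) ?scale0r//; apply/negbTE.
Qed.

Lemma seq_eval_MX a p : seq_eval a (p * 'X) = \sum_(k < size p) p`_k *: a k.+1.
Proof.
have h : (size (p * 'X)%R <= (size p).+1)%N.
  by apply: leq_trans (size_polyMleq _ _) _; rewrite size_polyX addn2.
rewrite (seq_eval_widen a h) big_ord_recl coefMX scale0r add0r.
by apply: eq_bigr => k _; rewrite coefMX.
Qed.

Lemma seq_eval_XsubC a p z : seq_eval a (p * ('X - z%:P)) = seq_eval a (p * 'X) - z *: seq_eval a p.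
Proof. by rewrite mulrBr raddfB /= [p * _%:P]mulrC mul_polyC linearZ. Qed.

End SequenceEvaluation.

(** * Polynomial calculus and the grid inequality *)

Section PolynomialCalculus.
Context {R : realType} {H : completeNormedModType R[i]}.
Context {dot : {dot H for Num.conj}}.
Context (hH : hilbert_norm dot).
Context {A : set (H * H)}.
Context (hA : self_adjoint dot A).
Local Notation ip := (inner dot).
Implicit Types (p q r s : {poly R[i]}) (a : nat -> H).

Definition chain n a := forall k, (k < n)%N -> A (a k, a k.+1).

Lemma graph_sum n (c : 'I_n -> R[i]) (x y : 'I_n -> H) :
  (forall k, A (x k, y k)) -> A (\sum_(k < n) c k *: x k, \sum_(k < n) c k *: y k).
Proof.
move=> h; apply: (big_ind2 (fun u v => A (u, v))); first exact: (graph0 hA).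
  by move=> *; exact: (graphD hA).
by move=> k _; exact: (graphZ hA).
Qed.

Lemma chain_seq_eval n a p : chain n a -> (size p <= n)%N -> A (seq_eval a p, seq_eval a (p * 'X)).
Proof.
move=> ha pn; rewrite seq_eval_MX /seq_eval; apply: graph_sum => k.
by apply: ha; exact: leq_trans (ltn_ord k) pn.
Qed.

(** The chain starts at the vector obtained from y by applying the resolvents at all
points of zs; each factor A - z undoes one of them. *)
Lemma chain_exists (zs : seq R[i]) y v : (forall z, z \in zs -> complex.Im z != 0) ->
  A (y, v) -> exists a, chain (size zs).+1 a /\ seq_eval a (\prod_(z <- zs) ('X - z%:P)) = y.
Proof.
move=> hz yv; elim: zs hz => [|z zs IH] hz.
  exists (fun k => if k is 0%N then y else v); split; last by rewrite big_nil seq_eval1.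
  by case.
have [|a [ha ea]] := IH; first by move=> w wz; apply: hz; rewrite inE wz orbT.
have z0 : complex.Im z != 0 by apply: hz; rewrite mem_head.
set n := (size zs).+1 in ha.
pose b k := if (k <= n)%N then Rz (A := A) z (a k) else a n + z *: Rz (A := A) z (a n).
have bS k : (k < n)%N -> b k.+1 = a k + z *: b k.
  move=> kn; rewrite /b kn (ltnW kn).
  apply: (graph_fun hA (Rz_comm_graph hH hA z0 (ha k kn))); exact: (RzP hH hA _ z0).
have hb : chain n.+1 b.
  move=> k; rewrite ltnS leq_eqVlt => /orP[/eqP->|kn].
    by rewrite /b leqnn ltnn; exact: (RzP hH hA).
  by rewrite bS// /b (ltnW kn); exact: (RzP hH hA).
exists b; split => //; rewrite big_cons mulrC seq_eval_XsubC seq_eval_MX -ea /seq_eval scaler_sumr -sumrB.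
apply: eq_bigr => k _; rewrite bS; last by rewrite /n -(size_prod_XsubC zs id).
by rewrite scalerDr !scalerA [z * _]mulrC addrK.
Qed.

(** By symmetry of A, <A^i x, A^j x> depends only on i + j. *)
Lemma chain_hankel n a : chain n a -> exists h : nat -> R[i]^o, forall i j,
  (i <= n)%N -> (j <= n)%N -> ip (a i) (a j) = h (i + j)%N.
Proof.
move=> ha; exists (fun m => ip (a (m - minn m n)%N) (a (minn m n))) => i j iN jN.
have shift t k l : (k + t <= n)%N -> (l + t <= n)%N ->
    ip (a (k + t)%N) (a l) = ip (a k) (a (l + t)%N).
  elim: t k l => [|t IH] k l; first by rewrite !addn0.
  rewrite !addnS => kt lt; rewrite -(graph_sym hA (ha _ kt) (ha _ (leq_ltn_trans (leq_addr t l) lt))).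
  rewrite IH; [by rewrite addSn|exact: ltnW|by rewrite addSn].
have e1 : (i = (i + j - minn (i + j) n) + (minn (i + j) n - j))%N.
  by rewrite addnBA ?leq_min ?leq_addl// subnK ?geq_minl// addnK.
have e2 : (minn (i + j) n = j + (minn (i + j) n - j))%N.
  by rewrite subnKC// leq_min leq_addl.
rewrite {1}e1 {4}e2; apply: shift; first by rewrite -e1.
by rewrite -e2 geq_minr.
Qed.

(** L is the moment functional 'X^m |-> <x, A^m x> of the first vector x of the chain. *)
Lemma chain_ip n a : chain n a -> exists L : {linear {poly R[i]} -> R[i]^o},
  forall p q, (size p <= n.+1)%N -> (size q <= n.+1)%N ->
  ip (seq_eval a p) (seq_eval a q) = L (conj_poly p * q).
Proof.
move=> ha; have [h hh] := chain_hankel ha; exists (seq_eval h) => p q pn qn.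
have -> : conj_poly p * q = \sum_(i < size p) \sum_(j < size q)
    (Num.conj p`_i * q`_j) *: 'X^(i + j).
  rewrite -{1}[conj_poly p]coefK -{1}[q]coefK !poly_def size_conj_poly mulr_suml.
  apply: eq_bigr => i _; rewrite mulr_sumr; apply: eq_bigr => j _.
  by rewrite coef_map /= -scalerAl -scalerAr scalerA exprD.
rewrite linear_sum {1}/seq_eval ip_suml; apply: eq_bigr => i _.
rewrite linear_sum ipZl {1}/seq_eval ip_sumr mulr_sumr; apply: eq_bigr => j _.
rewrite linearZ /= seq_eval_Xn ipZr mulrA; congr (_ * _); apply: hh.
  by rewrite -ltnS; exact: leq_trans (ltn_ord i) pn.
by rewrite -ltnS; exact: leq_trans (ltn_ord j) qn.
Qed.

Lemma chain_positive n a : chain n a -> exists L : {linear {poly R[i]} -> R[i]^o},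
  (forall p, (size p <= n.+1)%N -> L (conj_poly p * p) = ((nrm (seq_eval a p)) ^+ 2)%:C) /\
  (forall f : {poly R[i]}, (size f <= n.*2.+1)%N -> conj_poly f = f -> (forall x : R, 0 < f.[x%:C]) ->
   0 <= complex.Re (L f)).
Proof.
move=> ha; have [L hL] := chain_ip ha.
have h s : (size s <= n.+1)%N -> L (conj_poly s * s) = ((nrm (seq_eval a s)) ^+ 2)%:C.
  by move=> sn; rewrite -hL// (ipxx hH).
exists L; split => // f fn cf pf; have [s fs] := positive_poly_factor cf pf.
rewrite fs h /= ?sqr_ge0//.
have s0 : s != 0.
  by apply/negP => /eqP s0; have := pf 0; rewrite fs s0 mulr0 horner0 ltxx.
have c0 : conj_poly s != 0 by rewrite -size_poly_eq0 size_conj_poly size_poly_eq0.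
move: fn; rewrite fs size_mul// size_conj_poly addnn.
case: (size s) => [//|k]; rewrite doubleS /= ltnS => hk; rewrite ltnS.
by rewrite -leq_double.
Qed.

(** With P = prod_k (X - w_k) and q = P conj P, write y = q(A) x for the vector x of
[chain_exists]. Then (A - E0) y and R_{w_j} y are the values at A, on x, of
q (X - E0) and q / (X - w_j), and the difference of the two sides is L f for a
polynomial f that is positive on the real line. *)
Lemma grid_inequality n (e : 'I_n -> R) (E0 eps kap d2 : R) (y v : H) :
  0 < eps -> A (y, v) ->
  (forall x : R, d2 < (x - E0) ^+ 2 + kap * \sum_(j < n) ((x - e j) ^+ 2 + eps ^+ 2)^-1) ->
  d2 * (nrm y) ^+ 2 <= (nrm (v - E0%:C *: y)) ^+ 2 +
    kap * \sum_(j < n) (nrm (Rz (A := A) (e j +i* eps)%C y)) ^+ 2.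
Proof.
move=> eps0 yv hpos.
pose w j := (e j +i* eps)%C.
have w0 j : complex.Im (w j) != 0 by rewrite /= gt_eqF.
pose ws := [seq w j | j <- index_enum 'I_n].
pose zs := ws ++ [seq Num.conj z | z <- ws].
have hzs z : z \in zs -> complex.Im z != 0.
  have hws u : u \in ws -> complex.Im u != 0 by move=> /mapP[j _ ->].
  by rewrite mem_cat => /orP[/hws//|/mapP[u /hws u0 ->]]; exact: Im_conj_neq0.
have sws : size ws = n by rewrite /ws size_map -sum1_size sum1_card card_ord.
have szs : size zs = n.*2 by rewrite size_cat (size_map Num.conj) sws addnn.
have [a [ha ea]] := chain_exists hzs yv; rewrite szs in ha.
pose P := \prod_(j < n) ('X - (w j)%:P).
pose P' j := \prod_(k < n | k != j) ('X - (w k)%:P).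
have PE j : P = P' j * ('X - (w j)%:P) by rewrite /P (bigD1 j)//= mulrC.
have qE : \prod_(z <- zs) ('X - z%:P) = P * conj_poly P.
  rewrite big_cat /= !big_map; congr (_ * _).
  rewrite /conj_poly rmorph_prod; by apply: eq_bigr => j _; rewrite -conj_poly_XsubC.
rewrite qE in ea.
have sP : size P = n.+1 by rewrite /P size_prod_XsubC -sum1_size sum1_card card_ord.
have sq : (size (P * conj_poly P)%R <= n.*2.+1)%N.
  by apply: leq_trans (size_polyMleq _ _) _; rewrite size_conj_poly sP addSn addnS addnn.
have q0 : P * conj_poly P != 0 by rewrite mulf_neq0// -size_poly_eq0 ?size_conj_poly sP.
pose r j := P' j * conj_poly P.
have rq j : r j * ('X - (w j)%:P) = P * conj_poly P.
  by rewrite (PE j) /r -(PE j) mulrAC -(PE j).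
have sr j : (size (r j) <= n.*2)%N.
  rewrite -ltnS; apply: leq_trans sq; rewrite -(rq j).
  have r0 : r j != 0 by apply: contraNneq q0 => rj0; rewrite -(rq j) rj0 mul0r.
  by move: (r j) r0 => t t0; rewrite size_mul ?polyXsubC_eq0// size_XsubC addn2.
have evr j : seq_eval a (r j) = Rz (A := A) (w j) y.
  apply: (Rz_unique hH hA (w0 j)).
  have := chain_seq_eval ha (leqW (sr j)); congr (A (_, _)).
  by rewrite -ea -(rq j) seq_eval_XsubC subrK.
pose s0 := (P * conj_poly P) * ('X - (E0%:C)%:P).
have evs0 : seq_eval a s0 = v - E0%:C *: y.
  rewrite /s0 seq_eval_XsubC ea; congr (_ - _).
  by apply: (graph_fun hA _ yv); rewrite -{1}ea; exact: chain_seq_eval ha sq.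
have ss0 : (size s0 <= n.*2.+2)%N.
  apply: leq_trans (size_polyMleq _ _) _; rewrite size_XsubC addn2 /=.
  by rewrite ltnS.
have [L [hL posL]] := chain_positive ha.
pose q := P * conj_poly P.
pose f := conj_poly s0 * s0 - d2%:C *: (conj_poly q * q) + kap%:C *: \sum_(j < n) (conj_poly (r j) * r j).
have Lf : L f = ((nrm (v - E0%:C *: y)) ^+ 2 - d2 * (nrm y) ^+ 2 +
    kap * \sum_(j < n) (nrm (Rz (A := A) (w j) y)) ^+ 2)%:C.
  have -> : L f = L (conj_poly s0 * s0) - d2%:C * L (conj_poly q * q) +
      kap%:C * \sum_(j < n) L (conj_poly (r j) * r j).
    by rewrite /f linearD linearB !linearZ linear_sum.
  rewrite (hL _ ss0) (hL _ (leqW sq)) evs0 ea rcD rcB !rcM; congr (_ + _ * _); rewrite rmorph_sum /=; apply: eq_bigr => j _.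
  by rewrite hL ?evr// (leq_trans (sr j))// ltnW.
have szM (t : {poly R[i]}) m : (size t <= m.+1)%N -> (size (conj_poly t * t)%R <= m.*2.+1)%N.
  move=> tm; apply: leq_trans (size_polyMleq _ _) _; rewrite size_conj_poly addnn.
  by rewrite -ltnS; case: (size t) tm => // k; rewrite ltnS doubleS /= => km;
    rewrite !ltnS leq_double.
have : 0 <= complex.Re (L f).
  apply: posL.
  - rewrite /f; apply: leq_trans (size_polyD _ _) _; rewrite geq_max; apply/andP; split.
      apply: leq_trans (size_polyD _ _) _; rewrite geq_max szM//= size_polyN.
      by apply: leq_trans (size_scale_leq _ _) _; apply: szM; exact: leqW.
    apply: leq_trans (size_scale_leq _ _) _; apply: leq_trans (size_sum _ _ _) _.
    by apply/bigmax_leqP => j _; apply: szM; rewrite (leq_trans (sr j))// ltnW.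
  - have cs t : conj_poly (conj_poly t * t) = conj_poly t * t :> {poly R[i]}.
      by rewrite conj_polyM conj_polyK mulrC.
    rewrite /f /conj_poly rmorphD rmorphB /= !map_polyZ /= !conj_rc -/(conj_poly _) cs.
    rewrite -/(conj_poly _) cs; congr (_ + _ *: _).
    by rewrite rmorph_sum; apply: eq_bigr => j _; exact: cs.
  - move=> x; set Q := (cabs q.[x%:C]) ^+ 2.
    have xw j : (cabs ('X - (w j)%:P).[x%:C]) ^+ 2 = (x - e j) ^+ 2 + eps ^+ 2.
      by rewrite hornerXsubC cabs_sqr /= sub0r sqrrN.
    have xw0 j : 0 < (x - e j) ^+ 2 + eps ^+ 2.
      by rewrite ltr_wpDl ?sqr_ge0// exprn_gt0.
    have Q0 : 0 < Q.
      rewrite exprn_gt0// cabs_gt0//.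
      have P0 : P.[x%:C] != 0.
        rewrite /P horner_prod; apply/prodf_neq0 => j _; rewrite hornerXsubC.
        by rewrite eq_complex /= negb_and sub0r oppr_eq0 (gt_eqF eps0) orbT.
      by rewrite /q hornerM conj_poly_real mulf_neq0// fmorph_eq0.
    have rx j : (cabs (r j).[x%:C]) ^+ 2 = Q * ((x - e j) ^+ 2 + eps ^+ 2)^-1.
      apply: (canRL (mulfK (lt0r_neq0 (xw0 j)))).
      by rewrite -xw -exprMn -cabsM -hornerM rq.
    have sx : (cabs s0.[x%:C]) ^+ 2 = Q * (x - E0) ^+ 2.
      by rewrite /s0 hornerM cabsM exprMn hornerXsubC -rcB cabs_real real_normK ?num_real.
    have -> : f.[x%:C] = (Q * ((x - E0) ^+ 2 - d2 +
        kap * \sum_(j < n) ((x - e j) ^+ 2 + eps ^+ 2)^-1))%:C.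
      have -> : f.[x%:C] = (conj_poly s0 * s0).[x%:C] - d2%:C * (conj_poly q * q).[x%:C] +
          kap%:C * \sum_(j < n) (conj_poly (r j) * r j).[x%:C].
        by rewrite /f hornerD hornerD hornerN !hornerZ horner_sum.
      rewrite !conj_polyM_real sx -/Q.
      rewrite (eq_bigr (fun j => (Q * ((x - e j) ^+ 2 + eps ^+ 2)^-1)%:C)); last first.
        by move=> j _; rewrite conj_polyM_real rx.
      rewrite -rmorph_sum /= -mulr_sumr -!rcM -rcB -rcD; congr (_%:C); ring.
    by rewrite ltcR mulr_gt0//; have := hpos x; lra.
by rewrite Lf /=; lra.
Qed.

End PolynomialCalculus.

(** * The cyclicity space *)

Section CyclicSpace.
Context {R : realType} {H : completeNormedModType R[i]}.
Context {dot : {dot H for Num.conj}}.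
Context (hH : hilbert_norm dot).
Context {A : set (H * H)}.
Context (hA : self_adjoint dot A).
Context (u : H).
Implicit Types (z w : R[i]).
Local Notation S0 := [set x : H | exists z : R[i], complex.Im z != 0 /\ resolvent A z (u, x)].
Local Notation M := (cyclicity_space A u).

Lemma lin_span_lin a x y : lin_span S0 x -> lin_span S0 y -> lin_span S0 (a *: x + y).
Proof.
move=> [n [b [v [hv ->]]]] [m [c [t [ht ->]]]].
exists (n + m)%N, (fun k => match fintype.split k with inl i => a * b i | inr j => c j end),
  (fun k => match fintype.split k with inl i => v i | inr j => t j end); split.
  by move=> k; case: (fintype.split k).
rewrite big_split_ord /= scaler_sumr; congr (_ + _); apply: eq_bigr => k _.
  by rewrite (unsplitK (inl k)) scalerA.
by rewrite (unsplitK (inr k)).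
Qed.

Lemma cyclicity_closed x : (forall e : R, 0 < e -> exists2 s, M s & nrm (s - x) < e) -> M x.
Proof.
move=> h; apply/closureE => e e0; have e2 : 0 < e / 2 by rewrite divr_gt0.
have [s Ms sx] := h _ e2; have /closureE /(_ _ e2)[t St ts] := Ms.
by exists t => //; have := nrm_tri s t x; lra.
Qed.

Lemma cyclicity_lin a x y : M x -> M y -> M (a *: x + y).
Proof.
move=> /closureE Mx /closureE My; apply/closureE => e e0.
have a1 : 0 < cabs a + 1 by rewrite ltr_wpDl// cabs_ge0.
have [s Ss sx] := Mx _ (divr_gt0 (divr_gt0 e0 (@ltr0n R 2)) a1).
have [t St ty] := My _ (divr_gt0 e0 (@ltr0n R 2)).
exists (a *: s + t); first exact: lin_span_lin.
rewrite opprD addrACA -scalerBr.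
apply: le_lt_trans (nrmD _ _) _; rewrite nrmZ.
rewrite ltr_pdivlMr// in sx; have := nrm_ge0 (s - x); move: sx ty.
have := cabs_ge0 a; move: (nrm (s - x)) (nrm (t - y)) (cabs a) => p q r; nra.
Qed.

Lemma cyclicity0 : M 0.
Proof.
apply/closureE => e e0; exists 0; last by rewrite subrr nrm0.
by exists 0%N, (fun=> 0), (fun=> 0); split; [case|rewrite big_ord0].
Qed.

Lemma cyclicityB x y : M x -> M y -> M (x - y).
Proof. by move=> Mx My; rewrite addrC -scaleN1r; exact: cyclicity_lin. Qed.

Lemma Rz_cyclic z : complex.Im z != 0 -> M (Rz (A := A) z u).
Proof.
move=> z0; apply/closureE => e e0; exists (Rz (A := A) z u); last by rewrite subrr nrm0.
exists 1%N, (fun=> 1), (fun=> Rz (A := A) z u); split; last by rewrite big_ord1 scale1r.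
by move=> _; exists z; split => //; exact: (RzP hH hA).
Qed.

(** The resolvent identity gives the case w <> z; w = z follows by continuity. *)
Lemma Rz_Rz_cyclic w z : complex.Im z != 0 -> complex.Im w != 0 ->
  M (Rz (A := A) w (Rz (A := A) z u)).
Proof.
move=> z0; have neq t : complex.Im t != 0 -> t != z -> M (Rz (A := A) t (Rz (A := A) z u)).
  move=> t0 tz; have tz0 : t - z != 0 by rewrite subr_eq0.
  have -> : Rz (A := A) t (Rz (A := A) z u) =
      (t - z)^-1 *: (Rz (A := A) t u - Rz (A := A) z u) + 0.
    by rewrite (resolvent_identity hH hA u t0 z0) addrAC subrr add0r scalerA mulVf// scale1r addr0.
  by apply: cyclicity_lin cyclicity0; apply: cyclicityB; exact: Rz_cyclic.
move=> w0; have [->|] := eqVneq w z; last exact: neq.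
(* z' is near z and further from the real axis, where the resolvent is bounded
   by the same constant. *)
set x := Rz (A := A) z u; apply: cyclicity_closed => e e0.
set y := Rz (A := A) z x.
have y1 : 0 < nrm y + 1 by rewrite ltr_wpDl// nrm_ge0.
pose t := e / (nrm y + 1); have t0 : 0 < t by rewrite divr_gt0.
pose z' := z + ((t * complex.Im z) *i)%C.
have Iz' : complex.Im z' = (1 + t) * complex.Im z.
  by rewrite /z'; case: (z) => a b /=; ring.
have z'0 : complex.Im z' != 0 by rewrite Iz' mulf_neq0// gt_eqF// addr_gt0.
exists (Rz (A := A) z' x).
  apply: neq => //; rewrite -subr_eq0 /z' addrAC subrr add0r.
  by rewrite eq_complex /= eqxx mulf_neq0// gt_eqF.
rewrite (resolvent_identity hH hA x z'0 z0) addrAC subrr add0r -/y nrmZ.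
rewrite /z' addrAC subrr add0r cabs_iM -/z'.
have h := Rz_nrm hH hA y z'0; rewrite Iz' normrM in h.
rewrite normrM gtr0_norm//; rewrite gtr0_norm ?addr_gt0// in h.
have h2 : t * (nrm y + 1) = e by rewrite /t divfK// gt_eqF.
have := nrm_ge0 (Rz (A := A) z' y); have : 0 <= `|complex.Im z| by [].
have := nrm_ge0 y; move: h.
move: (nrm (Rz (A := A) z' y)) (`|complex.Im z|) => p q h3 h4 h5 h6.
have : 0 <= q * p by rewrite mulr_ge0.
nra.
Qed.

Lemma cyclicity_Rz w x : complex.Im w != 0 -> M x -> M (Rz (A := A) w x).
Proof.
move=> w0 /closureE Mx.
have Sp s : lin_span S0 s -> M (Rz (A := A) w s).
  move=> [n [a [v [hv ->]]]]; elim: n a v hv => [|n IH] a v hv.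
    by rewrite big_ord0 (Rz0 hH hA w0); exact: cyclicity0.
  rewrite big_ord_recl (Rz_lin hH hA)//; apply: cyclicity_lin; last exact: IH.
  have [z [z0 /(Rz_unique hH hA z0) /= ->]] := hv ord0.
  exact: Rz_Rz_cyclic.
apply: cyclicity_closed => e e0.
have b0 : 0 < `|complex.Im w| by rewrite normr_gt0.
have [s Ss sx] := Mx _ (mulr_gt0 b0 e0).
exists (Rz (A := A) w s); first exact: Sp.
rewrite -(RzB hH hA)// -(@ltr_pM2l _ `|complex.Im w|)//.
exact: le_lt_trans (Rz_nrm hH hA _ w0) sx.
Qed.

Lemma nonreal_resolvent_set z : complex.Im z != 0 -> resolvent_set M (op_restrict A M) z.
Proof.
move=> z0; split.
  move=> eta Meta; exists (Rz (A := A) z eta); split.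
    by split => /=; [exact: (RzP hH hA)|exact: cyclicity_Rz].
  by move=> x [/= hx _]; apply/esym; exact: (Rz_unique hH hA).
exists (`|complex.Im z|^-1) => eta x [/= hx _].
rewrite (Rz_unique hH hA z0 hx) !nrmE -rcM lecR ler_pdivlMl ?normr_gt0//.
exact: (Rz_nrm hH hA).
Qed.

Context (E0 d : R).
Context (d0 : 0 < d).
Context (gap : forall m w, M m -> complex.Im w != 0 ->
  d * nrm (Rz (A := A) w m) <= nrm (m + (w - E0%:C) *: Rz (A := A) w m)).

(** The gap inequality concerns vectors in the range of a resolvent; Yosida
approximation carries it over to every x in D(A) that lies in M, without
increasing the right-hand side. *)
Lemma gap_lower_bound eta x : M x -> A (x, eta + E0%:C *: x) -> d * nrm x <= nrm eta.
Proof.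
move=> Mx hx; rewrite -ler_pdivlMl//.
apply: tends_nrm_le (yosida_tends hH hA x) _; exists 0%N => n _.
rewrite ler_pdivlMl//; apply: le_trans (yosida_nrm hH hA n eta).
have w0 := @Im_in R n; have := gap Mx w0; set w := (n.+1%:R *i)%C in w0 *.
have -> : x + (w - E0%:C) *: Rz (A := A) w x = Rz (A := A) w eta.
  have := graph_fun hA (RzP hH hA x w0) (Rz_comm_graph hH hA w0 hx).
  rewrite (RzD hH hA)// (RzZ hH hA)// scalerBl addrA => ->.
  by rewrite addrK.
by move=> h; rewrite !nrmZ mulrCA ler_wpM2l// cabs_ge0.
Qed.

(** The preimage of eta is the limit of (A - E0 - i t)^-1 eta as t decreases to 0; the gap
inequality bounds these resolvents uniformly on M. *)
Lemma gap_resolvent_set : resolvent_set M (op_restrict A M) E0%:C.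
Proof.
have uniq eta x y : M x -> M y -> A (x, eta + E0%:C *: x) -> A (y, eta + E0%:C *: y) -> x = y.
  move=> Mx My hx hy; apply/eqP; rewrite -subr_eq0; apply/eqP/nrm_eq0/eqP.
  rewrite eq_le nrm_ge0 andbT -(@ler_pM2l _ d)// mulr0 -(@nrm0 R H).
  apply: gap_lower_bound; first exact: cyclicityB.
  have := graphB hA hx hy; congr (A (_, _)).
  by rewrite opprD addrACA subrr scalerBr.
split; last first.
  exists d^-1 => eta x [/= hx Mx]; rewrite !nrmE -rcM lecR ler_pdivlMl//.
  exact: gap_lower_bound.
move=> eta Meta.
pose t (n : nat) : R := d / 2 * n.+1%:R^-1.
have t0 n : 0 < t n by rewrite mulr_gt0 ?invr_gt0 ?ltr0n// divr_gt0.
have td n : t n <= d / 2.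
  by rewrite /t ler_piMr ?(ltW (divr_gt0 d0 _))// invf_le1 ?ltr0n// ler1n.
pose w n := (E0 +i* t n)%C.
have w0 n : complex.Im (w n) != 0 by rewrite /= gt_eqF.
have wE n : w n - E0%:C = ((t n) *i)%C.
  by apply/eqP; rewrite eq_complex /= subrr subr0 !eqxx.
have Rb n m : M m -> nrm (Rz (A := A) (w n) m) <= 2 / d * nrm m.
  move=> Mm; have := gap Mm (w0 n); rewrite wE.
  have := nrmD m (((t n) *i)%C *: Rz (A := A) (w n) m).
  rewrite nrmZ cabs_iM gtr0_norm// -[2 / d]invf_div ler_pdivlMl ?divr_gt0//.
  have := td n; have := nrm_ge0 (Rz (A := A) (w n) m).
  move: (nrm (_ + _)) => q; nra.
pose x n := Rz (A := A) (w n) eta.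
have xd n m : nrm (x n - x m) <= (t n + t m) * ((2 / d) ^+ 2 * nrm eta).
  rewrite /x (resolvent_identity hH hA eta (w0 n) (w0 m)) addrAC subrr add0r nrmZ.
  have -> : w n - w m = ((t n - t m) *i)%C by apply/eqP; rewrite eq_complex /= subrr !eqxx.
  rewrite cabs_iM; apply: ler_pM => //; first exact: nrm_ge0.
    apply: le_trans (ler_normB _ _) _; by rewrite !gtr0_norm.
  apply: le_trans (Rb n _ (cyclicity_Rz (w0 m) Meta)) _.
  rewrite expr2 -[leRHS]mulrA ler_wpM2l ?divr_ge0 ?(ltW d0)//.
  exact: Rb.
have tlim (C e : R) : 0 <= C -> 0 < e -> exists N, forall n, (N <= n)%N -> t n * C < e.
  move=> C0 e0; have C1 : 0 < d / 2 * (C + 1) by rewrite mulr_gt0 ?divr_gt0// ltr_wpDl.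
  have [N hN] := eventually_invS_lt (divr_gt0 e0 C1); exists N => n /hN.
  rewrite ltr_pdivlMr// /t; have : 0 < n.+1%:R^-1 :> R by rewrite invr_gt0 ltr0n.
  move: (n.+1%:R^-1) => i i0 h.
  apply: le_lt_trans h; have : 0 <= i * (d / 2) by rewrite mulr_ge0 ?divr_ge0 ?ltW.
  nra.
have K0 : 0 <= (2 / d) ^+ 2 * nrm eta by rewrite mulr_ge0 ?sqr_ge0 ?nrm_ge0.
have [y xy] : exists y, tends x y.
  apply: cauchy_tends => e e0; have e2 : 0 < e / 2 by rewrite divr_gt0.
  have [N hN] := tlim _ _ K0 e2; exists N => n m hn hm.
  apply: le_lt_trans (xd n m) _; have := hN _ hn; have := hN _ hm.
  rewrite mulrDl; lra.
have My : M y.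
  apply: cyclicity_closed => e /xy[N /(_ N (leqnn N)) h]; exists (x N) => //.
  exact: cyclicity_Rz.
have Ay : A (y, eta + E0%:C *: y).
  apply: (graph_closed hH hA (fun n => RzP hH hA eta (w0 n)) xy) => e e0.
  have e2 : 0 < e / 2 by rewrite divr_gt0.
  have [N hN] := tlim _ _ (mulr_ge0 (divr_ge0 (ler0n R 2) (ltW d0)) (nrm_ge0 eta)) e2.
  have [N' hN'] := tendsZ E0%:C xy e2.
  exists (maxn N N') => n hn.
  have := hN' _ (leq_trans (leq_maxr _ _) hn); have := hN _ (leq_trans (leq_maxl _ _) hn).
  have -> : eta + w n *: Rz (A := A) (w n) eta - (eta + E0%:C *: y) =
      (E0%:C *: x n - E0%:C *: y) + ((t n) *i)%C *: x n.
    rewrite opprD addrACA subrr add0r -wE scalerBl -/(x n).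
    by rewrite [RHS]addrC subrKA.
  have := nrmD (E0%:C *: x n - E0%:C *: y) (((t n) *i)%C *: x n).
  rewrite nrmZ cabs_iM gtr0_norm//; have := Rb n _ Meta; rewrite -/(x n).
  have := t0 n; move: (nrm (_ + _)) (2 / d * nrm eta) => q r; nra.
exists y; split; first by split.
by move=> y' [/= hy' My']; apply: (@uniq eta).
Qed.

End CyclicSpace.

(** * Intervals of regular energies are spectral gaps *)

(** At distance more than d from E0 the first term suffices. Otherwise some grid point
is within h of x, and its summand alone contributes at least 2 d^2. *)
Lemma grid_cover (R : realType) (E0 d : R) (n : nat) (h := 2 * d / n.+1%:R)
    (e := fun j : 'I_n.+2 => E0 - d + j%:R * h) (x : R) : 0 < d ->
  d ^+ 2 < (x - E0) ^+ 2 + 4 * d ^+ 2 * h ^+ 2 *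
    \sum_(j < n.+2) ((x - e j) ^+ 2 + h ^+ 2)^-1.
Proof.
move=> d0; have h0 : 0 < h by rewrite divr_gt0 ?mulr_gt0.
have t0 j : 0 < ((x - e j) ^+ 2 + h ^+ 2)^-1.
  by rewrite invr_gt0 ltr_wpDl ?sqr_ge0// exprn_gt0.
have s0 : 0 <= 4 * d ^+ 2 * h ^+ 2 * \sum_(j < n.+2) ((x - e j) ^+ 2 + h ^+ 2)^-1.
  apply: mulr_ge0; last by apply: sumr_ge0 => j _; exact: ltW.
  by apply: mulr_ge0; [apply: mulr_ge0|]; rewrite ?sqr_ge0.
have [xd|dx] := leP `|x - E0| d; last first.
  rewrite ltr_wpDr// -[ltRHS]real_normK ?num_real//.
  by rewrite ltr_pXn2r ?nnegrE ?(ltW d0).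
have {}xd : - d <= x - E0 <= d by rewrite -ler_norml.
pose t := (x - E0 + d) / h.
have tge : 0 <= t by rewrite divr_ge0 ?(ltW h0)//; case/andP: xd; lra.
have nh : n.+1%:R * h = 2 * d by rewrite /h mulrCA divff ?mulr1// pnatr_eq0.
have tle : t <= n.+1%:R by rewrite ler_pdivrMr// nh; case/andP: xd; lra.
have /andP[k1 k2] := truncn_itv tge.
have kn : (Num.truncn t < n.+2)%N.
  by rewrite ltnS -(ler_nat R); exact: le_trans k1 tle.
pose j := Ordinal kn.
have xe : (x - e j) ^+ 2 <= h ^+ 2.
  have th : t * h = x - E0 + d by rewrite /t divfK// gt_eqF.
  have -> : x - e j = (t - j%:R) * h by rewrite mulrBl th /e; ring.
  rewrite exprMn ler_piMl ?sqr_ge0//.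
  have : 0 <= t - j%:R <= 1 by rewrite subr_ge0 k1 /= lerBlDl natr1 ltW.
  by move: (t - j%:R) => q /andP[q0 q1]; rewrite expr2; nra.
have hj : d ^+ 2 < 4 * d ^+ 2 * h ^+ 2 * ((x - e j) ^+ 2 + h ^+ 2)^-1.
  rewrite ltr_pdivlMr; last by rewrite ltr_wpDl ?sqr_ge0// exprn_gt0.
  have : 0 < d ^+ 2 by rewrite exprn_gt0.
  have : 0 < h ^+ 2 by rewrite exprn_gt0.
  move: xe; move: ((x - e j) ^+ 2) (h ^+ 2) (d ^+ 2) => p q r; nra.
have : 4 * d ^+ 2 * h ^+ 2 * ((x - e j) ^+ 2 + h ^+ 2)^-1 <=
    4 * d ^+ 2 * h ^+ 2 * \sum_(j < n.+2) ((x - e j) ^+ 2 + h ^+ 2)^-1.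
  apply: ler_wpM2l; first by apply: mulr_ge0; [apply: mulr_ge0|]; rewrite ?sqr_ge0.
  by rewrite (bigD1 j)//= lerDl; apply: sumr_ge0 => k _; exact: ltW.
by have := sqr_ge0 (x - E0); lra.
Qed.

Section Gap.
Context {R : realType} {H : completeNormedModType R[i]}.
Context {dot : {dot H for Num.conj}}.
Context (hH : hilbert_norm dot).
Context {A : set (H * H)}.
Context (hA : self_adjoint dot A).
Implicit Types (z w : R[i]).

(** The vectors with resolvents bounded up to the real axis over [E0 - d, E0 + d]; the
height 1/2 keeps the strip away from the point i. *)
Definition strip_bounded (E0 d C : R) (y : H) := forall e eps : R,
  `|e - E0| <= d -> 0 < eps -> eps < 2^-1 -> nrm (Rz (A := A) (e +i* eps)%C y) <= C.

(** In the grid inequality of mesh h the error term is at most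
4 d^2 h^2 (n + 2) C^2, with h of order 1/n, and so tends to 0. *)
Lemma strip_bounded_gap (E0 d C : R) y v : 0 < d -> strip_bounded E0 d C y -> A (y, v) ->
  d * nrm y <= nrm (v - E0%:C *: y).
Proof.
move=> d0 hC yv.
rewrite -(@ler_pXn2r _ 2) ?nnegrE ?mulr_ge0 ?nrm_ge0 ?(ltW d0)// exprMn.
have K0 : 0 <= 32 * d ^+ 4 * C ^+ 2.
  by apply: mulr_ge0; rewrite ?sqr_ge0// mulr_ge0// exprn_ge0// ltW.
apply: (le_of_eps K0) => e e0.
have [N hN] := eventually_invS_lt e0.
have [N' hN'] := eventually_invS_lt (divr_gt0 (@ltr01 R) (mulr_gt0 (@ltr0n R 4) d0)).
pose n := maxn N N'.
have h1 := hN n (leq_maxl _ _); have h2 := hN' n (leq_maxr _ _).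
pose h := 2 * d / n.+1%:R.
have h0 : 0 < h by rewrite divr_gt0 ?mulr_gt0.
have h12 : h < 2^-1.
  rewrite ltr_pdivlMr ?mulr_gt0// in h2; rewrite /h; move: h2.
  move: (n.+1%:R^-1) => i; lra.
have := grid_inequality hH hA h0 yv (fun x => grid_cover E0 n x d0); rewrite -/h => hg.
apply: le_trans hg _; rewrite lerD2l.
set s := \sum_(j < _) _.
have hs : s <= n.+2%:R * C ^+ 2.
  rewrite -[n.+2 in leRHS]card_ord mulr_natl -sumr_const; apply: ler_sum => j _.
  rewrite ler_pXn2r ?nnegrE ?nrm_ge0//; last first.
    by apply: le_trans (nrm_ge0 _) (hC E0 h _ h0 h12); rewrite subrr normr0 ltW.
  apply: hC => //; rewrite -/h.
  have -> : E0 - d + j%:R * h - E0 = j%:R * h - d by ring.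
  have : j%:R <= n.+1%:R :> R by rewrite ler_nat -ltnS.
  have nh : n.+1%:R * h = 2 * d by rewrite /h mulrCA divff ?mulr1// pnatr_eq0.
  have : 0 <= j%:R :> R by [].
  move=> j0 jn; rewrite ler_norml; apply/andP; split.
    by rewrite lerBrDl subrr mulr_ge0// ltW.
  rewrite lerBlDr (_ : d + d = 2 * d); last by ring.
  by rewrite -nh ler_pM2r.
have k0 : 0 <= 4 * d ^+ 2 * h ^+ 2.
  by apply: mulr_ge0; [apply: mulr_ge0|]; rewrite ?sqr_ge0.
apply: le_trans (ler_wpM2l k0 hs) _.
have i0 : 0 < n.+1%:R^-1 :> R by rewrite invr_gt0 ltr0n.
have ni : n.+2%:R * n.+1%:R^-1 <= 2 :> R.
  rewrite ler_pdivrMr ?ltr0n// -[n.+2%:R]natr1 mulrDl mul1r lerD2l.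
  by rewrite ler1n.
have -> : 4 * d ^+ 2 * h ^+ 2 * (n.+2%:R * C ^+ 2) =
    16 * d ^+ 4 * C ^+ 2 * (n.+2%:R * n.+1%:R^-1 * n.+1%:R^-1).
  by rewrite /h; ring.
have L0 : 0 <= d ^+ 4 * C ^+ 2.
  by apply: mulr_ge0; rewrite ?sqr_ge0// exprn_ge0// ltW.
have : n.+2%:R * n.+1%:R^-1 * n.+1%:R^-1 <= 2 * e.
  by apply: ler_pM; [apply: mulr_ge0; rewrite ?(ltW i0)|exact: ltW|exact: ni|exact: ltW].
move: (_ * _ * n.+1%:R^-1) => X hX; have := ler_wpM2l L0 hX.
rewrite -[16 * _ * _]mulrA -[32 * _ * _]mulrA; move: (_ * C ^+ 2) => D; lra.
Qed.

Context {phi : H -> R[i]}.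
Context (phi_lin : forall a x y x' y', A (x, y) -> A (x', y') ->
  phi (a *: x + x') = a * phi x + phi x').
Context (phi_bd : exists K, 0 <= K /\
  forall x y, A (x, y) -> cabs (phi x) <= K * (nrm y + nrm x)).
Context (phiH : ~ in_H dot A phi).
Local Notation u := (gen_resolvent dot A phi 'i).
Local Notation M := (cyclicity_space A u).

Section RegularInterval.
Context (E0 d K : R).
Context (d0 : 0 < d).
Context (reg : forall E : R, `|E - E0| <= d -> regular (A := A) (phi := phi) K E).

(** By the resolvent identity (w - i) R_w (A - i)^-1 phi is the difference of
(A - w)^-1 phi and (A - i)^-1 phi, both of controlled norm. *)
Lemma strip_bounded_gen_resolvent : strip_bounded E0 d (2 * (K + nrm u)) u.
Proof.
move=> e eps he eps0 eps1; set w := (e +i* eps)%C.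
have w0 : complex.Im w != 0 by rewrite /= gt_eqF.
have h1 : nrm (gen_resolvent dot A phi w) <= K.
  exact: (regular_gen_resolvent hH hA phi_lin phi_bd phiH w0 (reg he)).
have h2 := gen_resolvent_Rz hH hA phi_lin phi_bd w0.
have h3 : cabs (w - 'i) * nrm (Rz (A := A) w u) <= K + nrm u.
  rewrite -nrmZ; have -> : (w - 'i) *: Rz (A := A) w u = gen_resolvent dot A phi w - u.
    by rewrite h2 addrAC subrr add0r.
  by apply: le_trans (nrmB _ _) _; rewrite lerD2r.
have h4 : 2^-1 <= cabs (w - 'i).
  apply: le_trans (cabs_Im_le _); rewrite -complexiE /= -normrN opprB.
  by apply: le_trans (ler_norm _); lra.
have := nrm_ge0 (Rz (A := A) w u); nra.
Qed.

Lemma strip_bounded_span s :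
  lin_span [set x | exists z : R[i], complex.Im z != 0 /\ resolvent A z (u, x)] s ->
  exists C, strip_bounded E0 d C s.
Proof.
move=> [n [a [v [hv ->]]]]; elim: n a v hv => [|n IH] a v hv.
  exists 0 => e eps _ eps0 _; rewrite big_ord0 (Rz0 hH hA) ?nrm0//.
  by rewrite /= gt_eqF.
have [C1 hC1] := IH (fun k => a (lift ord0 k)) (fun k => v (lift ord0 k)) (fun k => hv _).
have [z [z0 /(Rz_unique hH hA z0) /= ev]] := hv ord0.
pose C2 := `|complex.Im z|^-1 * (2 * (K + nrm u)).
exists (cabs (a ord0) * C2 + C1) => e eps he eps0 eps1.
have w0 : complex.Im (e +i* eps)%C != 0 by rewrite /= gt_eqF.
rewrite big_ord_recl (Rz_lin hH hA)//; apply: le_trans (nrmD _ _) _.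
apply: lerD; last exact: hC1.
rewrite nrmZ ler_wpM2l ?cabs_ge0// ev (Rz_comm hH hA)//.
rewrite /C2 ler_pdivlMl ?normr_gt0//; apply: le_trans (Rz_nrm hH hA _ z0) _.
exact: strip_bounded_gen_resolvent.
Qed.

(** Resolvents commute, so R_w preserves [strip_bounded]; this proves the inequality
on the span of the vectors (A - z)^-1 (A - i)^-1 phi, and both sides are
continuous in m. *)
Lemma regular_interval_gap m w : M m -> complex.Im w != 0 ->
  d * nrm (Rz (A := A) w m) <= nrm (m + (w - E0%:C) *: Rz (A := A) w m).
Proof.
move=> /closureE Mm w0; set b := `|complex.Im w|.
have b0 : 0 < b by rewrite normr_gt0.
pose Rw := Rz (A := A) w.
have hs s : lin_span [set x | exists z : R[i], complex.Im z != 0 /\ resolvent A z (u, x)] s ->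
    d * nrm (Rw s) <= nrm (s + (w - E0%:C) *: Rw s).
  move=> /strip_bounded_span[C hC].
  rewrite scalerBl addrA; apply: (@strip_bounded_gap _ _ (b^-1 * C)) => //; last first.
    exact: (RzP hH hA).
  move=> e eps he eps0 eps1.
  have w'0 : complex.Im (e +i* eps)%C != 0 by rewrite /= gt_eqF.
  rewrite (Rz_comm hH hA _ w'0 w0).
  by rewrite ler_pdivlMl//; apply: le_trans (Rz_nrm hH hA _ w0) _; exact: hC.
have Rb x : nrm (Rw x) <= b^-1 * nrm x by rewrite ler_pdivlMl//; exact: (Rz_nrm hH hA).
pose L := 1 + cabs (w - E0%:C) * b^-1 + d * b^-1.
have bi : 0 < b^-1 by rewrite invr_gt0.
have cw := cabs_ge0 (w - E0%:C).
have L0 : 0 <= L by rewrite !addr_ge0// mulr_ge0// ltW.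
apply: (le_of_eps L0) => e e0; have [s Ss sm] := Mm _ e0.
have h1 := hs _ Ss; have h2 := Rb (s - m).
have h3 := nrm_tri (Rw s) (Rw m) 0; rewrite !subr0 (nrm_sub (Rw m)) -(RzB hH hA)// in h3.
have h4 : nrm (s + (w - E0%:C) *: Rw s) <=
    nrm (m + (w - E0%:C) *: Rw m) + (nrm (s - m) + cabs (w - E0%:C) * nrm (Rw (s - m))).
  have -> : s + (w - E0%:C) *: Rw s =
      (m + (w - E0%:C) *: Rw m) + ((s - m) + (w - E0%:C) *: Rw (s - m)).
    rewrite addrACA [m + _]addrC subrK -scalerDr; congr (_ + _ *: _).
    by rewrite /Rw (RzB hH hA)// addrC subrK.
  apply: le_trans (nrmD _ _) _; rewrite lerD2l; apply: le_trans (nrmD _ _) _.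
  by rewrite nrmZ.
have h5 : nrm (Rw (s - m)) <= b^-1 * e.
  by apply: le_trans h2 _; rewrite ler_wpM2l ?ltW.
have h6 := ler_wpM2l cw h5; have h7 := ler_wpM2l (ltW d0) h5.
have h8 := ler_wpM2l (ltW d0) h3.
rewrite /L; move: h1 h4 h6 h7 h8 sm; rewrite -/Rw.
move: (nrm (Rw s)) (nrm (Rw m)) (nrm (Rw (s - m))) (nrm (s - m)) => p q r t; lra.
Qed.

Lemma regular_interval_resolvent_set : resolvent_set M (op_restrict A M) E0%:C.
Proof.
apply: (gap_resolvent_set hH hA d0) => m w Mm w0; exact: regular_interval_gap.
Qed.

End RegularInterval.
End Gap.

(** * The coupling function *)

Section CouplingFunction.
Context {R : realType} {H : completeNormedModType R[i]}.
Context {dot : {dot H for Num.conj}}.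
Context (hH : hilbert_norm dot).
Context {A : set (H * H)}.
Context (hA : self_adjoint dot A).
Context {phi : H -> R[i]}.
Context (phi_lin : forall a x y x' y', A (x, y) -> A (x', y') ->
  phi (a *: x + x') = a * phi x + phi x').
Context (phi_bd : exists K, 0 <= K /\
  forall x y, A (x, y) -> cabs (phi x) <= K * (nrm y + nrm x)).
Context (phiH : ~ in_H dot A phi).
Local Notation ip := (inner dot).
Local Notation g := (defect_vec dot A phi).
Local Notation u := (gen_resolvent dot A phi 'i).
Local Notation M := (cyclicity_space A u).
Local Notation sol E psi := (weak_resolvent (dot := dot) (A := A) (phi := phi) (E%:C) psi).
Local Notation reg := (regular (A := A) (phi := phi)).
Implicit Types (E K : R).

(** The number <phi, psi - A (A^2 + I)^-1 phi> for psi = (A - E)^-1 phi, which equals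
- 1/alpha - c when E is an eigenvalue of A_{alpha,c} on M with alpha <> 0. It does
not depend on the choice of psi, by [couplingE]. *)
Definition coupling E : R := complex.Re (phi (xget 0 [set psi | sol E psi] - g)).

Lemma couplingE E p : sol E p -> coupling E = complex.Re (phi (p - g)).
Proof.
move=> hp; rewrite /coupling.
have := @xgetPex _ 0 [set psi | sol E psi] (ex_intro _ p hp).
set q := xget _ _ => hq.
have [y1 h1] := weak_resolvent_defect hH hA phi_lin phi_bd hp.
have [y2 h2] := weak_resolvent_defect hH hA phi_lin phi_bd hq.
apply/eqP; rewrite -subr_eq0 -ReB -(phiB hA phi_lin h2 h1).
by rewrite opprB addrA subrK (phi_weak_resolvent_diff hA hq hp) subrr mul0r.
Qed.

Lemma coupling_diff E E' p q : sol E p -> sol E' q ->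
  coupling E - coupling E' = (E - E') * complex.Re (ip q p).
Proof.
move=> hp hq; rewrite (couplingE hp) (couplingE hq).
have [y1 h1] := weak_resolvent_defect hH hA phi_lin phi_bd hp.
have [y2 h2] := weak_resolvent_defect hH hA phi_lin phi_bd hq.
rewrite -ReB -(phiB hA phi_lin h1 h2).
by rewrite opprB addrA subrK (phi_weak_resolvent_diff hA hp hq) ReZ.
Qed.

Lemma coupling_lip K E E' : 0 <= K -> reg K E -> reg K E' ->
  `|coupling E - coupling E'| <= K ^+ 2 * `|E - E'|.
Proof.
move=> K0 hE hE'.
have [p [hp pK _]] := regular_weak_resolvent hH hA phi_lin K0 hE.
have [q [hq qK _]] := regular_weak_resolvent hH hA phi_lin K0 hE'.
rewrite (coupling_diff hp hq) normrM mulrC ler_wpM2r//.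
apply: le_trans (_ : cabs (ip q p) <= _).
  rewrite -lecR -normCE; exact: normc_ge_Re.
apply: le_trans (CauchySchwarz hH q p) _.
by rewrite expr2 ler_pM// nrm_ge0.
Qed.

Lemma regular_closed K E : 0 <= K ->
  (forall e, 0 < e -> exists2 E', reg K E' & `|E' - E| < e) -> reg K E.
Proof.
move=> K0 h x y xy; have K1 : 0 <= K * nrm x by rewrite mulr_ge0 ?nrm_ge0.
apply: (le_of_eps K1) => e e0; have [E' hE' EE'] := h _ e0.
apply: le_trans (hE' _ _ xy) _; rewrite -mulrA -mulrDr ler_wpM2l//.
have -> : y - E'%:C *: x = (y - E%:C *: x) - (E' - E)%:C *: x.
  by rewrite rcB scalerBl opprB addrA subrK.
apply: le_trans (nrmB _ _) _; rewrite lerD2l nrmZ cabs_real mulrC.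
by rewrite ler_wpM2l ?nrm_ge0// ltW.
Qed.

(** The difference quotient at E is Re <psi, psi'>. As E' tends to E through K-regular
energies, psi' converges weakly to psi: it is bounded, and its pairing with
(A - E) x is phi x + (E' - E) <psi', x>. So the quotient tends to |psi|^2. *)
Lemma coupling_slope K E : 0 <= K -> reg K E -> exists m : nat,
  forall E', reg K E' -> `|E' - E| < m.+1%:R^-1 ->
  (E' - E) ^+ 2 * m.+1%:R^-1 <= (coupling E' - coupling E) * (E' - E).
Proof.
move=> K0 hE; have [p [hp pK Vp]] := regular_weak_resolvent hH hA phi_lin K0 hE.
have p0 : 0 < nrm p.
  have [x [y [xy px]]] := phi_neq0 phiH.
  apply: nrm_gt0; apply: contra_neq px => pz.
  by rewrite -(hp _ _ xy) pz ip0l.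
set N := (nrm p) ^+ 2; have N0 : 0 < N by rewrite exprn_gt0.
pose eta := N / (8 * (K + 1)); have K1 : 0 < K + 1 by rewrite ltr_wpDl.
have eta0 : 0 < eta by rewrite divr_gt0// mulr_gt0.
have Ke : K * eta <= N / 8.
  rewrite /eta mulrCA ler_wpM2l ?(ltW N0)// ler_pdivrMr ?mulr_gt0//.
  by rewrite mulrA mulVf ?pnatr_eq0// mul1r lerDl ler01.
have /closureE /(_ _ eta0)[s [x hx] sp] := Vp.
have phix : ip p s = phi x by rewrite -(hp _ _ hx) conj_rc addrK.
pose r := N / (4 * (K * nrm x + 1)).
have Kx : 0 <= K * nrm x by rewrite mulr_ge0 ?nrm_ge0.
have r0 : 0 < r by rewrite divr_gt0// mulr_gt0// ltr_wpDl.
have [m hm] := eventually_invS_lt r0; have [m' hm'] := eventually_invS_lt (divr_gt0 N0 (@ltr0n R 2)).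
exists (maxn m m') => E' hE' EE'.
have h1 := hm _ (leq_maxl m m'); have h2 := hm' _ (leq_maxr m m').
set n := maxn m m' in EE' h1 h2 *.
have [q [hq qK _]] := regular_weak_resolvent hH hA phi_lin K0 hE'.
rewrite (coupling_diff hq hp) [X in _ <= X]mulrAC -expr2 ler_wpM2l ?sqr_ge0//.
(* s is close to p and pairs with p and q to almost the same value phi x, so
   <p, q> is close to |p|^2. *)
have e1 : ip q p = - ip q (s - p) + phi x + (E' - E)%:C * ip q x.
  have := hq _ _ hx; rewrite conj_rc => <-.
  by rewrite !ipBr ipDr !ipZr rcB; ring.
have e2 : N%:C = - ip p (s - p) + phi x.
  by rewrite ipBr phix -(ipxx hH); ring.
have e3 : complex.Re (ip p q) = N - complex.Re (ip q (s - p)) + complex.Re (ip p (s - p)) +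
    (E' - E) * complex.Re (ip q x).
  rewrite ipC Re_conj e1 !ReD ReN ReZ.
  have /(congr1 (@complex.Re R)) := e2; rewrite ReD ReN /= => ->; ring.
rewrite e3.
have b1 : complex.Re (ip q (s - p)) <= N / 8.
  apply: le_trans (Re_le_cabs _) (le_trans (CauchySchwarz hH _ _) _).
  by apply: le_trans Ke; apply: ler_pM => //; rewrite ?nrm_ge0 ?ltW.
have b2 : - complex.Re (ip p (s - p)) <= N / 8.
  rewrite -ReN -ipNr; apply: le_trans (Re_le_cabs _) (le_trans (CauchySchwarz hH _ _) _).
  by rewrite nrmN; apply: le_trans Ke; apply: ler_pM => //; rewrite ?nrm_ge0 ?ltW.
have b3 : - ((E' - E) * complex.Re (ip q x)) <= N / 4.
  apply: le_trans (ler_norm _) _; rewrite normrN normrM.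
  have b4 : `|complex.Re (ip q x)| <= K * nrm x.
    apply: le_trans (_ : cabs (ip q x) <= _).
      rewrite -lecR -normCE; exact: normc_ge_Re.
    by apply: le_trans (CauchySchwarz hH q x) _; rewrite ler_wpM2r ?nrm_ge0.
  have b5 : r * (K * nrm x + 1) = N / 4.
    by rewrite /r invfM mulrA divfK// gt_eqF// ltr_wpDl.
  rewrite -b5; apply: ler_pM => //; last by apply: le_trans b4 _; rewrite lerDl.
  exact: ltW (lt_trans EE' h1).
move: h2 b1 b2 b3; move: (complex.Re (ip q (s - p))) (complex.Re (ip p (s - p))).
move: ((E' - E) * complex.Re (ip q x)) (n.+1%:R^-1) => *; lra.
Qed.

(** The slope is required to be uniform in E, both in its size and in the range of E'
over which it holds; this makes [coupling] monotone on short intervals. *)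
Definition slope_set K (m : nat) : set R := [set E | reg K E /\
  forall E', reg K E' -> `|E' - E| < m.+1%:R^-1 ->
  (E' - E) ^+ 2 * m.+1%:R^-1 <= (coupling E' - coupling E) * (E' - E)].

Lemma slope_set_closed K m : 0 <= K -> closed (slope_set K m).
Proof.
move=> K0; apply: closed_eps => E h.
have rE : reg K E.
  apply: regular_closed => // e /h[E' [rE' _] hE']; by exists E'.
split=> // E' rE' EE'.
set k := m.+1%:R^-1 in EE' *.
have k0 : 0 < k by rewrite /k invr_gt0 ltr0n.
have k1 : k <= 1 by rewrite /k invf_le1 ?ltr0n// ler1n.
pose D := E' - E; pose G := coupling E' - coupling E.
have C0 : 0 <= 2 * `|D| + `|G| + K ^+ 2 * (`|D| + 1).
  by rewrite !addr_ge0// mulr_ge0 ?sqr_ge0// addr_ge0.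
apply: (le_of_eps C0) => e e0.
pose e' := Num.min e (Num.min 1 (k - `|E' - E|)).
have e'0 : 0 < e' by rewrite !lt_min e0 ltr01 subr_gt0.
have [F [rF hF] FE] := h _ e'0.
have [fe [f1 fk]] : `|F - E| < e /\ `|F - E| < 1 /\ `|F - E| < k - `|E' - E|.
  by move: FE; rewrite !lt_min => /andP[-> /andP[-> ->]].
have EF : `|E' - F| < k.
  have -> : E' - F = (E' - E) - (F - E) by ring.
  apply: le_lt_trans (ler_normB _ _) _; lra.
have := hF _ rE' EF.
have hL := coupling_lip K0 rF rE.
have -> : E' - F = D - (F - E) by rewrite /D; ring.
have -> : coupling E' - coupling F = G - (coupling F - coupling E) by rewrite /G; ring.
rewrite -/D -/G; move: (F - E) (coupling F - coupling E) fe f1 hL => t v fe f1 hL hv.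
have n1 : `|D * t| <= `|D| * e by rewrite normrM ler_wpM2l// ltW.
have n2 : `|G * t| <= `|G| * e by rewrite normrM ler_wpM2l// ltW.
have v1 : `|v| <= K ^+ 2 * e by apply: le_trans hL _; rewrite ler_wpM2l ?sqr_ge0// ltW.
have n3 : `|v * (D - t)| <= K ^+ 2 * e * (`|D| + 1).
  rewrite normrM; apply: ler_pM => //.
  by apply: le_trans (ler_normB _ _) _; rewrite lerD2l ltW.
have m1 := ler_norm (D * t); have m2 := ler_norm (- (G * t)).
have m3 := ler_norm (- (v * (D - t))); rewrite normrN in m2; rewrite normrN in m3.
have a1 : (D - t) ^+ 2 * k >= D ^+ 2 * k - 2 * (`|D| * e).
  have : D * t * k <= `|D| * e.
    apply: le_trans (ler_norm _) _; rewrite normrM [`|k|]gtr0_norm//.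
    by apply: le_trans n1; rewrite ler_piMr.
  have : 0 <= t ^+ 2 * k by rewrite mulr_ge0 ?sqr_ge0// ltW.
  have -> : (D - t) ^+ 2 * k = D ^+ 2 * k - 2 * (D * t * k) + t ^+ 2 * k by ring.
  lra.
have a2 : (G - v) * (D - t) = G * D - G * t - v * (D - t) by ring.
rewrite a2 in hv.
have -> : (2 * `|D| + `|G| + K ^+ 2 * (`|D| + 1)) * e =
  2 * (`|D| * e) + `|G| * e + K ^+ 2 * e * (`|D| + 1) by ring.
move: hv a1 n2 n3 m2 m3; move: (D ^+ 2 * k) ((D - t) ^+ 2 * k) (G * D) (G * t).
move: (v * (D - t)) (`|D| * e) (`|G| * e) (K ^+ 2 * e * (`|D| + 1)) => *; lra.
Qed.

(** A closed set that contains the real spectrum of A on M, by [spectrum_gap_free]. *)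
Definition gap_free : set R :=
  ~` \bigcup_(n in [set: nat]) [set E | reg n%:R E]°.

Lemma spectrum_gap_free E : spectrum M (op_restrict A M) E%:C -> gap_free E.
Proof.
move=> sE [n _ /nbhs_ballP[d /= d0 hd]]; apply: sE.
have d2 : 0 < d / 2 by rewrite divr_gt0.
apply: (regular_interval_resolvent_set hH hA phi_lin phi_bd phiH d2 (K := n%:R)).
by move=> F hF; apply: hd; rewrite /ball /= distrC; apply: le_lt_trans hF _; lra.
Qed.

(** The interval is half as long as the range over which the slope condition holds. *)
Definition monotone_piece (i : nat * nat * int) : set R :=
  let: (n, m, k) := i in
  gap_free `&` slope_set n%:R m `&`
  [set` `[k%:~R / (2 * m.+1%:R), (k%:~R + 1) / (2 * m.+1%:R)]].

Lemma monotone_piece_closed i : closed (monotone_piece i).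
Proof.
case: i => [[n m] k]; apply: closedI; last exact: itv_closed.
apply: closedI; last exact: slope_set_closed.
by apply: open_closedC; apply: bigcup_open => j _; exact: open_interior.
Qed.

Lemma monotone_piece_empty_interior i : empty_interior (monotone_piece i).
Proof.
case: i => [[n m] k] a b ab; apply: contrapT => h.
have hp t : a < t < b -> monotone_piece (n, m, k) t.
  by move=> tab; apply: contrapT => ht; apply: h; exists t.
have [[]] := hp ((a + b) / 2) ltac:(apply/andP; split; lra).
move=> gf _ _; apply: gf; exists n => //.
apply/nbhs_ballP; exists ((b - a) / 2) => /=; first by rewrite divr_gt0// subr_gt0.
move=> t; rewrite /ball /= ltr_norml => /andP[t1 t2].
by have [[_ []]] := hp t ltac:(apply/andP; split; lra).
Qed.

Lemma monotone_piece_increasing i E E' : monotone_piece i E -> monotone_piece i E' -> E < E' ->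
  coupling E < coupling E'.
Proof.
case: i => [[n m] k] [[_ [rE hE]] IE] [[_ [rE' _]] IE'] EE'.
have k0 : 0 < m.+1%:R^-1 :> R by rewrite invr_gt0 ltr0n.
have d0 : 0 < E' - E by rewrite subr_gt0.
have := hE _ rE'; rewrite gtr0_norm// => /(_ _) h.
have : E' - E < m.+1%:R^-1.
  move: IE IE'; rewrite /= !in_itv /= => /andP[a1 _] /andP[_ a2].
  have e : (2 * m.+1%:R)^-1 = m.+1%:R^-1 / 2 :> R by rewrite invfM mulrC.
  rewrite e mulrDl mul1r in a2; rewrite e in a1; move: a1 a2 k0.
  move: (m.+1%:R^-1) => q; move: (k%:~R * (q / 2)) => p; lra.
move=> /h {}h; rewrite -subr_gt0 -(pmulr_lgt0 _ d0).
by apply: lt_le_trans h; rewrite mulr_gt0// exprn_gt0.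
Qed.

Lemma monotone_piece_image i : closed (coupling @` monotone_piece i) /\ empty_interior (coupling @` monotone_piece i).
Proof.
split; last first.
  apply: increasing_image_empty_interior; first exact: monotone_piece_closed.
    exact: monotone_piece_empty_interior.
  by move=> x y; exact: monotone_piece_increasing.
case: i => [[n m] k].
apply: (closed_image_lip (L := n%:R ^+ 2) (@monotone_piece_closed (n, m, k)) (fun x hx => hx.2)) => x y [[_ [hx _]] _] [[_ [hy _]] _].
exact: coupling_lip.
Qed.

Lemma monotone_piece_cover E K : gap_free E -> reg K E -> exists i, monotone_piece i E.
Proof.
move=> gE rE; pose n := Num.bound `|K|.
have rn : reg n%:R E.
  move=> x y xy; apply: le_trans (rE _ _ xy) _; rewrite ler_wpM2r ?nrm_ge0//.
  by apply: le_trans (ler_norm _) _; exact: ltW (archi_boundP (normr_ge0 K)).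
have [m hm] := coupling_slope (ler0n R n) rn.
exists (n, m, Num.floor (E * (2 * m.+1%:R))); split; first by split.
have k0 : 0 < 2 * m.+1%:R :> R by rewrite mulr_gt0 ?ltr0n.
rewrite /= in_itv /= ler_pdivrMr// ler_pdivlMr//.
have /andP[f1 f2] := floor_itv (E * (2 * m.+1%:R)).
by rewrite f1 /= ltW// -intrD1.
Qed.

End CouplingFunction.

(** * Generic absence of embedded eigenvalues *)

Theorem theorem1p2 (R : realType) (H : completeNormedModType R[i])
  (dot : {dot H for Num.conj}) (hH : hilbert_norm dot)
  (A : set (H * H)) (hA : self_adjoint dot A)
  (phi : H -> R[i]) (hphi : in_Hm2 dot A phi) (hphiH : ~ in_H dot A phi)
  (c : R) :
  exists G : set R, [/\ Gdelta G, dense G & G `<=` Gamma dot A phi c].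
Proof.
have [phi_lin phi_bd] := in_Hm2_bounded hH hA hphi.
pose P := coupling (dot := dot) (A := A) (phi := phi).
pose K (i : nat) : set R :=
  if unpickle i is Some j then P @` monotone_piece (dot := dot) (A := A) (phi := phi) j else set0.
have pim := monotone_piece_image hH hA phi_lin phi_bd.
have cK i : closed (K i).
  by rewrite /K; case: unpickle => [j|]; [exact: (pim j).1|exact: closed0].
have eK i : empty_interior (K i).
  rewrite /K; case: unpickle => [j|]; first exact: (pim j).2.
  by move=> a b ab; exists ((a + b) / 2) => //; apply/andP; split; lra.
have [G [GG dG hG]] := generic_parameters c cK eK.
exists G; split => // alpha /hG[al0 hal].
rewrite /Gamma /=; apply/seteqP; split => // z [[v [v0 [/= hv Mv]]] sz].
have [Iz|Iz] := eqVneq (complex.Im z) 0; last first.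
  by apply: sz; exact: (nonreal_resolvent_set hH hA).
have zE : z = (complex.Re z)%:C by case: (z) Iz => a b /= ->.
rewrite zE in hv sz.
have [psi [spsi hpsi]] := eigenvector_weak_resolvent hH hA phi_lin phi_bd hphiH al0 v0 hv Mv.
have rE := weak_resolvent_regular hH spsi (lexx _).
have gE := spectrum_gap_free hH hA phi_lin phi_bd hphiH sz.
have [j hj] := monotone_piece_cover hH hA phi_lin phi_bd hphiH gE rE.
apply: (hal (pickle j)); rewrite /K pickleK; exists (complex.Re z) => //.
rewrite /P (couplingE hH hA phi_lin phi_bd spsi).
apply/eqP; rewrite -subr_eq opprK; apply/eqP.
by apply: (mulfI al0); rewrite hpsi mulrN divff.
Qed.
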